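(* Let $E$ be a separable Banach space. Then $E$ does not contain a copy of $c_0$ if and only if for every doubly power-bounded operator $T\in\mathscr{L}(E)$ and every vector $x\in E$ the following three conditions are equivalent: (a) the set $\{T^{n+m}x-T^nx : n\in\mathbb{N}\}$ is relatively compact in $E$ for some $m\in\mathbb{N}$, $m\ge 1$; (b) the set $\{T^{n+m}x-T^nx : n\in\mathbb{N}\}$ is relatively compact in $E$ for all $m\in\mathbb{N}$, $m\ge 1$; (c) the set $\{T^nx : n\in\mathbb{N}\}$ is relatively compact in $E$.
   Context: $\mathscr{L}(E)$ denotes the bounded linear operators on $E$. An operator $T\in\mathscr{L}(E)$ is power-bounded if $\sup_{n\in\mathbb{N}}\|T^n\|<\infty$; it is doubly power-bounded if it is invertible with $T^{-1}\in\mathscr{L}(E)$ and both $T$ and $T^{-1}$ are power-bounded. $c_0$ is the Banach space of null sequences with the supremum norm. ''$E$ contains a copy of $c_0$'' means that $E$ has a closed subspace isomorphic (linearly homeomorphic) to $c_0$. *)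

(* Defs.v *)
From HB Require Import structures.
From mathcomp Require Import all_boot all_order all_algebra.
From mathcomp Require Import all_classical all_reals all_analysis.
From mathcomp Require Import complex.

Set Implicit Arguments.
Unset Strict Implicit.
Unset Printing Implicit Defensive.

Import Order.TTheory GRing.Theory Num.Theory.
Import numFieldNormedType.Exports.

Local Open Scope classical_set_scope.
Local Open Scope ring_scope.

(* The scalar field of a Banach space is the field of real or of complex
   numbers. *)
Inductive real_or_complex : numFieldType -> Prop :=
| RealScalars (R : realType) : real_or_complex R
| ComplexScalars (R : realType) : real_or_complex R[i].

Definition separable (T : topologicalType) : Prop :=
  exists D : set T, countable D /\ dense D.

Section NullSequences.
Variable K : numFieldType.

Definition null_sequence : {pred nat -> K^o} :=
  fun x => `[< x @ \oo --> (0 : K^o) >].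

Lemma null_sequence_submod : submod_closed null_sequence.
Proof.
split; first by apply/asboolP; exact: cvg_cst.
move=> a x y /asboolP x0 /asboolP y0; apply/asboolP.
have -> : (0 : K^o) = a *: (0 : K^o) + 0 by rewrite scaler0 addr0.
by apply: cvgD => //; apply: cvgZ => //; exact: cvg_cst.
Qed.

HB.instance Definition _ :=
  GRing.isSubmodClosed.Build K (nat -> K^o) null_sequence null_sequence_submod.

Record c0 := C0 { c0_val :> nat -> K^o; c0_valP : c0_val \in null_sequence }.

HB.instance Definition _ := [isSub for c0_val].
HB.instance Definition _ := [Choice of c0 by <:].
HB.instance Definition _ := [SubChoice_isSubLmodule of c0 by <:].

(* Norms take their values in K, also when K is the field of complex numbers;
   the order of K is then partial, but the supremum below still exists, because
   a null sequence attains its largest modulus. *)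
Definition c0_norm (x : c0) : K := supremum 0 (range (fun n => `|x n|)).

Lemma c0_norm_attained (x : c0) :
  exists2 n, c0_norm x = `|x n| & forall m, `|x m| <= `|x n|.
Proof.
suff [n xn] : exists n, forall m, `|x m| <= `|x n|.
  exists n => //; rewrite /c0_norm /supremum ifF; last first.
    by apply/negbTE/set0P; exists `|x n|, n.
  apply: xget_unique; first by split=> [_ [m _ <-]//|y]; apply; exists n.
  move=> y [uy ly]; apply/eqP; rewrite eq_le ly/=; last by move=> _ [m _ <-].
  by apply: uy; exists n.
have [x0|] := pselect (forall m, x m = 0).
  by exists 0%N => m; rewrite !x0.
move=> /existsNP[k /eqP xk0].
have /asboolP/cvgrPdist_lt/(_ `|x k|) := c0_valP x.
rewrite normr_gt0 => /(_ xk0)[N _ xN].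
have real_x m : `|x m| \is Num.real by exact: normr_real.
suff [n xn] : exists n, forall m, (m < N.+1 + k)%N -> `|x m| <= `|x n|.
  exists n => m; have [mN|mN] := ltnP m (N.+1 + k); first exact: xn.
  have /xN/= : (N <= m)%N by apply: leq_trans mN; rewrite addSn leqW// leq_addr.
  rewrite sub0r normrN => /ltW/le_trans; apply; apply: xn.
  by rewrite addSn ltnS leq_addl.
elim: (N.+1 + k)%N => [|M [n xn]]; first by exists 0%N.
have /orP[h|h] : (`|x n| <= `|x M|) || (`|x M| <= `|x n|).
- by rewrite -/(_ >=< _) real_comparable.
- exists M => m; rewrite ltnS leq_eqVlt => /predU1P[->//|/xn/le_trans]; exact.
- by exists n => m; rewrite ltnS leq_eqVlt => /predU1P[->//|/xn].
Qed.

Lemma c0_ler_normD (x y : c0) : c0_norm (x + y) <= c0_norm x + c0_norm y.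
Proof.
have [n -> _] := c0_norm_attained (x + y).
have [i -> xi] := c0_norm_attained x; have [j -> yj] := c0_norm_attained y.
by apply: le_trans (ler_normD _ _) _; exact: lerD.
Qed.

Lemma c0_normrZ (a : K) (x : c0) : c0_norm (a *: x) = `|a| * c0_norm x.
Proof.
have [i -> axi] := c0_norm_attained (a *: x).
have [j -> xj] := c0_norm_attained x.
have axE m : `|(a *: x) m| = `|a| * `|x m| by rewrite -normrM.
apply/eqP; rewrite eq_le; apply/andP; split; first by rewrite axE ler_wpM2l.
by rewrite -axE axi.
Qed.

Lemma c0_normr0_eq0 (x : c0) : c0_norm x = 0 -> x = 0.
Proof.
have [i -> xi] := c0_norm_attained x => xi0; apply/val_inj/funext => m.
by apply/eqP; rewrite -normr_le0 -[leRHS]xi0.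
Qed.

HB.instance Definition _ :=
  Lmodule_isNormed.Build K c0 c0_ler_normD c0_normrZ c0_normr0_eq0.

End NullSequences.

Section Operators.
Variables (K : numFieldType) (E : normedModType K).

Definition contains_copy_of_c0 : Prop :=
  exists F : set E, [/\ closed F, submod_closed [in F] &
    exists (J : {linear c0 K -> E}) (J' : E -> c0 K),
      [/\ range J = F, cancel J J', continuous J & {within F, continuous J'}]].

(* [T] is an element of L(E) when it is linear and satisfies this predicate. *)
Definition bounded_operator (T : E -> E) : Prop := bounded_near T (nbhs 0).

(* As for [c0_norm], the supremum in K of moduli bounded above exists if K is
   the field of real or of complex numbers. *)
Definition opnorm (T : E -> E) : K :=
  supremum 0 [set `|T x| | x in [set x : E | `|x| <= 1]].

Definition power_bounded (T : E -> E) : Prop :=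
  has_ubound (range (fun n => opnorm (iter n T))).

Definition doubly_power_bounded (T : E -> E) : Prop :=
  power_bounded T /\
  exists S : {linear E -> E},
    [/\ bounded_operator S, cancel T S, cancel S T & power_bounded S].

End Operators.

(* Main.v *)
Require Import Defs.
From HB Require Import structures.
From mathcomp Require Import all_boot all_order all_algebra.
From mathcomp Require Import all_classical all_reals all_analysis.
From mathcomp Require Import finmap complex ring.
Set Implicit Arguments.
Unset Strict Implicit.
Unset Printing Implicit Defensive.

Import Order.TTheory GRing.Theory Num.Theory.
Import numFieldNormedType.Exports.
Local Open Scope classical_set_scope.
Local Open Scope ring_scope.

(** Since (c) implies (b) and (b) implies (a) in every Banach space, the point is
    that (a) implies (c) exactly when the separable space contains no copy of
    [c0]. In a Banach space relatively compact
    means totally bounded.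

    Suppose that [T] and its inverse are power-bounded, that the differences
    [T^{n+m} x - T^n x] are totally bounded and that the orbit of [x] is not.
    Replacing [T] by [T^m], let [m = 1] and [y = T x - x]. Then [y] is almost
    periodic, while some almost periods [n] of arbitrarily good quality displace
    [x] by a fixed amount ([displaced_almost_period]). Choosing such [n_1],
    [n_2], ... fast enough, the vectors [T^{n_i} x - x] are bounded away from 0
    and have bounded subset sums, because [T^s x - x] is almost additive in [s]
    ([displacements_subset_sums]). By the theorem of Bessaga and Pelczynski such
    a sequence yields a copy of [c0]; James's distortion argument proves this
    without functionals, as the blocks on which the norm is nearly largest are
    equivalent to the unit vectors of [c0] ([james_blocks]).

    Conversely, let a permutation rotate larger and larger finite blocks of
    indices, and let [w] be a bounded sequence that varies slowly along each
    block. The permutation moves [w] by a null sequence and so acts on the span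
    of [c0] and [w]; there the differences of the orbit of [w] are relatively
    compact, but the orbit is not ([c0_counterexample], which transfers this span
    to [c0]). By Sobczyk's theorem
    ([sobczyk]) a copy of [c0] in a separable space is complemented, so the
    operator extends by the identity on a complement. Sobczyk's theorem needs the
    Hahn-Banach theorem ([hahn_banach]), proved for real functionals by Zorn's
    lemma and transferred to [K].

    Real and complex scalars are treated together: norms are real elements of
    [K], bounded sets of which have suprema ([real_or_complex_sup]), and a scalar
    decomposes along [real_part]. *)

(** * Scalars *)

(** The device that treats both scalar fields at once: [re] is the real part and
    [c] is the imaginary unit, or 0 if all scalars are real. Since
    [Re (i * z) = - Im z], the last field is [z = Re z + i * Im z]. *)
Record real_part (K : numFieldType) (c : K) (re : K -> K) : Prop := RealPart {
  real_part_unit : c = 0 \/ c * c = -1;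
  real_part_real : forall z, re z \is Num.real;
  real_partD : forall z w, re (z + w) = re z + re w;
  real_partM : forall t z, t \is Num.real -> re (t * z) = t * re z;
  real_part_le : forall z, `|re z| <= `|z|;
  real_partE : forall z, z = re z - c * re (c * z) }.

Lemma real_part_unit_le (K : numFieldType) (c : K) re :
  real_part c re -> `|c| <= 1.
Proof.
move=> reP; have [->|cc] := real_part_unit reP; first by rewrite normr0.
by rewrite -(@ler_pXn2r _ 2%N) ?nnegrE // -normrX expr2 cc normrN1 expr1n.
Qed.

Lemma real_or_complex_real_part (K : numFieldType) :
  real_or_complex K -> exists c re, @real_part K c re.
Proof.
case=> R.
  exists 0, id; split=> //; first by left.
  - by move=> z; exact: num_real.
  - by move=> z; rewrite mul0r subr0.
exists 'i, (fun z : R[i] => 'Re z); split.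
- by right; rewrite -expr2 sqrCi.
- by move=> z; exact: Creal_Re.
- by move=> z w; rewrite raddfD.
- by move=> t z t_real; rewrite ReMl.
- by move=> z; exact: (leif_normC_Re_Creal z).
- by move=> z; rewrite ReMil mulrN opprK -Crect.
Qed.

(** Over the complex numbers the order is partial, but an upper bound of a
    nonempty set of reals is comparable to a real, hence real. *)
Lemma real_or_complex_sup (K : numFieldType) (A : set K) :
  real_or_complex K -> A !=set0 -> (forall x, A x -> x \is Num.real) ->
  has_ubound A -> exists s, supremums A s.
Proof.
move=> Kroc; case: Kroc A => R A [a Aa] A_real [b Ab].
  have supA : has_sup A by split; [exists a | exists b].
  exists (sup A); split; first by move=> x Ax; exact: sup_upper_bound.
  by move=> y Ay; apply: ge_sup => //; exists a.
have AE x : A x -> (complex.Re x)%:C%C = x by move=> /A_real /RRe_real.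
have ubE y : ubound A y -> (complex.Re y)%:C%C = y.
  move=> /(_ a Aa) ay; apply: RRe_real.
  by rewrite -(ler_real ay); exact: A_real.
pose B := [set r : R | A r%:C%C].
have supB : has_sup B.
  split; first by exists (complex.Re a); rewrite /B /= AE.
  by exists (complex.Re b) => r Br; rewrite -lecR ubE //; exact: Ab.
exists (sup B)%:C%C; split.
  move=> x Ax; rewrite -(AE x Ax) lecR; apply: sup_upper_bound => //.
  by rewrite /B /= AE.
move=> y Ay; rewrite -(ubE y Ay) lecR; apply: ge_sup; first exact: supB.1.
by move=> r Br; rewrite -lecR ubE //; exact: Ay.
Qed.

Section Scalars.
Variables (K : numFieldType) (Kroc : real_or_complex K).

Lemma supremum_real (A : set K) s a :
  A a -> a \is Num.real -> supremums A s -> s \is Num.real.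
Proof. by move=> Aa a_real [As _]; rewrite -(ler_real (As a Aa)). Qed.

Lemma supremum_adherent (A : set K) s t :
  A !=set0 -> (forall x, A x -> x \is Num.real) -> supremums A s ->
  t \is Num.real -> t < s -> exists2 x, A x & t < x.
Proof.
move=> [a Aa] A_real supA t_real ts; apply: contrapT => Nx.
suff /(supA.2 t) : ubound A t.
  by move=> st; have := le_lt_trans st ts; rewrite ltxx.
move=> x Ax; rewrite (real_leNgt (A_real x Ax) t_real); apply/negP => tx.
by apply: Nx; exists x.
Qed.

(** [K] carries no archimedean structure. Were [e / q ^+ n] bounded in [n], its
    supremum [s] would satisfy [q * s < e / q ^+ n] for some [n], hence
    [s < e / q ^+ n.+1]. *)
Lemma geometric_lt (q C e : K) : 0 <= q < 1 -> 0 < e -> C \is Num.real ->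
  exists N, forall n, (N <= n)%N -> C * q ^+ n < e.
Proof.
move=> /andP[q0 q1] e0 C_real.
have [C0|C0] : C <= 0 \/ 0 < C.
- have /orP[?|] := real_leVge C_real (real0 K); [by left|].
  by rewrite le_eqVlt => /predU1P[<-|]; [left|right].
- exists 0%N => n _; apply: le_lt_trans e0.
  by rewrite mulr_le0_ge0 // exprn_ge0.
suff [N hN] : exists N, C * q ^+ N < e.
  exists N => n Nn; apply: le_lt_trans hN; apply: ler_wpM2l; first exact: ltW.
  by apply: ler_wiXn2l => //; exact: ltW.
apply: contrapT => /forallNP big.
have {}big n : e <= C * q ^+ n.
  have Cq_real : C * q ^+ n \is Num.real by rewrite realM // realX // ger0_real.
  rewrite (real_leNgt (gtr0_real e0) Cq_real).
  by apply/negP; exact: big.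
have q_gt0 : 0 < q.
  rewrite lt_neqAle q0 andbT; apply/eqP => q_eq0; have := big 1%N.
  by rewrite -q_eq0 expr1 mulr0 => /lt_le_trans -/(_ _ e0); rewrite ltxx.
pose A := [set e / q ^+ n | n in [set: nat]].
have A_real x : A x -> x \is Num.real.
  by move=> [n _ <-]; rewrite gtr0_real // divr_gt0 // exprn_gt0.
have A0 : A !=set0 by exists (e / q ^+ 0), 0%N.
have [|s sA] := @real_or_complex_sup K A Kroc A0 A_real.
  by exists C => _ [n _ <-]; rewrite ler_pdivrMr ?exprn_gt0.
have s_gt0 : 0 < s.
  by apply: lt_le_trans (sA.1 _ (ex_intro2 _ _ 0%N I erefl)); rewrite expr0 divr1.
have [||_ [n _ <-] qs] := @supremum_adherent A s (q * s) A0 A_real sA.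
- by rewrite gtr0_real // mulr_gt0.
- by rewrite -subr_gt0 -{1}[s]mul1r -mulrBl mulr_gt0 // subr_gt0.
have := sA.1 _ (ex_intro2 _ _ n.+1 I erefl).
rewrite exprSr invfM mulrA ler_pdivrMr // (mulrC s) => le.
by have := lt_le_trans qs le; rewrite ltxx.
Qed.

Lemma half_powers_small (e : K) : 0 < e ->
  exists N, forall n, (N <= n)%N -> 2^-1 ^+ n < e.
Proof.
move=> e0; have [|N hN] := @geometric_lt 2^-1 1 e _ e0 (real1 K).
  by rewrite invr_ge0 ler0n /= invf_lt1 ?ltr0n // ltr1n.
by exists N => n /hN; rewrite mul1r.
Qed.

(** The limit is the supremum of the [t] that lie below [f] almost everywhere
    for [U]. *)
Lemma real_ultralimit (U : set_system nat) (UU : UltraFilter U) (f : nat -> K)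
    (B : K) :
  (forall n, f n \is Num.real) -> (forall n, `|f n| <= B) ->
  exists l, forall e, 0 < e -> U [set n | `|f n - l| <= e].
Proof.
move=> f_real fB.
pose A := [set t | t \is Num.real /\ U [set n | t <= f n]].
have B0 : 0 <= B by apply: le_trans (fB 0%N).
have fB' n : - B <= f n <= B by rewrite -real_ler_norml.
have A0 : A !=set0.
  exists (- B); split; first by rewrite realN ger0_real.
  by apply: filterS filterT => n _; have /andP[] := fB' n.
have A_real t : A t -> t \is Num.real by case.
have [|s sA] := @real_or_complex_sup K A Kroc A0 A_real.
  exists B => t [_ /filter_ex[n /= tn]]; apply: le_trans tn _.
  by have /andP[] := fB' n.
have s_real : s \is Num.real.
  by have [a Aa] := A0; apply: supremum_real Aa (A_real _ Aa) sA.
exists s => e e0.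
have [||t [t_real Ut] st] := @supremum_adherent A s (s - e) A0 A_real sA.
- by rewrite realB // gtr0_real.
- by rewrite ltrBlDr ltrDl.
have Ue : U [set n | f n <= s + e].
  have [//|UN] := in_ultra_setVsetC [set n | f n <= s + e] UU.
  suff : A (s + e) by move=> /(sA.1); rewrite gerDl => /lt_le_trans -/(_ _ e0); rewrite ltxx.
  split; first by rewrite realD // gtr0_real.
  have se_real : s + e \is Num.real by rewrite realD // gtr0_real.
  apply: filterS UN => n /= /negP; rewrite -(real_ltNge se_real (f_real n)).
  exact: ltW.
apply: filterS2 Ut Ue => n /= tn ne.
rewrite real_ler_norml ?realB // lerBrDl [X in _ && X]lerBlDl ne andbT.
by apply: le_trans tn; apply: ltW.
Qed.

(** Compactness of the discs of [K], in the form that serves both for weak-star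
    limits of functionals and for coordinatewise limits of sequences. *)
Lemma ultralimit (U : set_system nat) (UU : UltraFilter U) (f : nat -> K)
    (B : K) : (forall n, `|f n| <= B) ->
  exists l, forall e, 0 < e -> U [set n | `|f n - l| <= e].
Proof.
move=> fB; have [c [re reP]] := real_or_complex_real_part Kroc.
have [l1 l1P] : exists l, forall e, 0 < e -> U [set n | `|re (f n) - l| <= e].
  apply: (@real_ultralimit U UU _ B) => n; first exact: real_part_real reP _.
  by apply: le_trans (fB n); exact: real_part_le reP _.
have c1 := real_part_unit_le reP.
have [l2 l2P] :
    exists l, forall e, 0 < e -> U [set n | `|re (c * f n) - l| <= e].
  apply: (@real_ultralimit U UU _ B) => n; first exact: real_part_real reP _.
  apply: le_trans (real_part_le reP _) _; rewrite normrM.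
  by apply: le_trans (fB n); rewrite ler_piMl.
exists (l1 - c * l2) => e e0; have e20 : 0 < e / 2 by rewrite divr_gt0.
apply: filterS2 (l1P _ e20) (l2P _ e20) => n /= h1 h2.
rewrite [f n](real_partE reP).
have -> : re (f n) - c * re (c * f n) - (l1 - c * l2) =
  re (f n) - l1 - c * (re (c * f n) - l2) by ring.
rewrite (splitr e); apply: le_trans (ler_normB _ _) _; apply: lerD => //.
by rewrite normrM; apply: le_trans h2; rewrite ler_piMl.
Qed.

End Scalars.

(** * Totally bounded sets *)

Section TotallyBounded.
Variable K : numFieldType.

Definition totally_bounded (V : normedModType K) (A : set V) : Prop :=
  forall e : K, 0 < e ->
    exists s : seq V, forall x, A x -> exists2 y, y \in s & `|x - y| < e.

Lemma precompact_totally_bounded (V : normedModType K) (A : set V) :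
  precompact A -> totally_bounded A.
Proof.
rewrite precompactE compact_cover => Aco e e0.
have [||D _ DA] := Aco V setT (fun y => ball y e).
- by move=> y _; exact: ball_open.
- by move=> x _; exists x => //; exact: ballxx.
exists (enum_fset D) => x /subset_closure /DA[y yD].
by rewrite -ball_normE /= distrC; exists y.
Qed.

(** One of the finitely many balls that cover [A] belongs to the ultrafilter,
    which is therefore Cauchy. *)
Lemma totally_bounded_precompact (V : completeNormedModType K) (A : set V) :
  totally_bounded A -> precompact A.
Proof.
move=> Atb; rewrite precompactE compact_ultra => F FU FA.
suff /cauchy_cvg/cvg_ex[l Fl] : cauchy F.
  exists l; split=> //; apply: (@closed_cvg _ _ F _ id) Fl => //.
  exact: closed_closure.
apply/cauchyP => e e0; have [s sA] := Atb _ (divr_gt0 e0 (ltr0n K 2)).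
have : F [set x | exists2 y, y \in s & `|x - y| < e].
  apply: filterS FA => x /(_ (ball x (e / 2))).
  case; first by apply: nbhsx_ballx; rewrite divr_gt0.
  move=> z [/sA[y ys zy]]; rewrite -ball_normE /= => xz; exists y => //.
  rewrite (splitr e) -(subrKA z).
  by apply: le_lt_trans (ler_normD _ _) _; exact: ltrD.
elim: s {sA} => [|y s IH] Fs.
  by have /filter_ex[x [y]] := Fs; rewrite in_nil.
have [Fy|Fy] := in_ultra_setVsetC [set x | `|x - y| < e] FU.
  by exists y; apply: filterS Fy => x /=; rewrite -ball_normE /= distrC.
apply: IH; apply: filterS2 Fs Fy => x /= [z]; rewrite inE => /predU1P[->//|].
by move=> zs xz _; exists z.
Qed.

Lemma totally_bounded_sub (V : normedModType K) (A B : set V) :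
  A `<=` B -> totally_bounded B -> totally_bounded A.
Proof.
by move=> AB Btb e /Btb[s sB]; exists s => x /AB /sB.
Qed.

Lemma totally_bounded_lipschitz (V W : normedModType K) (f : V -> W) (M : K)
    (A : set V) :
  0 <= M -> (forall x y, `|f x - f y| <= M * `|x - y|) ->
  totally_bounded A -> totally_bounded (f @` A).
Proof.
move=> M0 fM Atb e e0; have M1 : 0 < M + 1 by rewrite ltr_wpDl.
have [s sA] := Atb _ (divr_gt0 e0 M1).
exists (map f s) => _ [x /sA[y ys xy] <-]; exists (f y); first exact: map_f.
apply: le_lt_trans (fM x y) _; move: xy; rewrite ltr_pdivlMr // => xy.
by apply: le_lt_trans xy; rewrite mulrC ler_wpM2l // lerDl.
Qed.

Lemma totally_bounded_bigcup (V : normedModType K) (A : nat -> set V) n :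
  (forall i, (i < n)%N -> totally_bounded (A i)) ->
  totally_bounded (\bigcup_(i in [set i | (i < n)%N]) A i).
Proof.
move=> Atb e e0.
have /choice[s sP] : forall i, exists s : seq V, (i < n)%N ->
    forall x, A i x -> exists2 y, y \in s & `|x - y| < e.
  move=> i; have [/Atb/(_ e e0)[s sA]|_] := ltnP i n; first by exists s.
  by exists [::].
exists (flatten [seq s i | i <- iota 0 n]) => x [i /= i_n /(sP i i_n)[y ys xy]].
by exists y => //; apply/flatten_mapP; exists i => //; rewrite mem_iota.
Qed.

End TotallyBounded.

(** * The Hahn-Banach theorem *)

Section HahnBanach.
Variables (K : numFieldType) (Kroc : real_or_complex K) (E : normedModType K).
Variables (C : K) (C0 : 0 <= C).

(** Partial real-linear functionals dominated by [C * `|x|] are represented by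
    their graphs, so that a chain of them has its union as an upper bound.
    Single-valuedness is a consequence of the domination: if [(x, r)] and
    [(x, s)] lie in the graph, then so does [(0, r - s)]. *)
Definition real_functional_graph (G : set (E * K)) : Prop :=
  [/\ G (0, 0),
      forall x r, G (x, r) -> r \is Num.real /\ r <= C * `|x| &
      forall t x r y s, t \is Num.real -> G (x, r) -> G (y, s) ->
        G (x + t *: y, r + t * s)].

Let C_real : C \is Num.real. Proof. exact: ger0_real. Qed.

(** The value [al] at [x0] has to satisfy
    [r - C * `|y - x0| <= al <= C * `|z + x0| - s] for all [(y, r)] and [(z, s)]
    in [G]; the left sides are below the right sides because
    [r + s <= C * `|y + z|]. *)
Lemma extend_real_functional_graph (G : set (E * K)) (x0 : E) :
  real_functional_graph G -> exists G',
    [/\ real_functional_graph G', G `<=` G' & exists r, G' (x0, r)].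
Proof.
move=> [G00 Gle Glin].
have Glin0 t x r : t \is Num.real -> G (x, r) -> G (t *: x, t * r).
  by move=> t_real /(Glin t _ _ _ _ t_real G00); rewrite !add0r.
pose A := [set p.2 - C * `|p.1 - x0| | p in G].
have A0 : A !=set0 by exists (0 - C * `|0 - x0|), (0, 0).
have A_real a : A a -> a \is Num.real.
  by move=> [[y r] /Gle[r_real _] <-]; rewrite realB // realM // normr_real.
have ubA z s : G (z, s) -> ubound A (C * `|z + x0| - s).
  move=> Gzs _ [[y r] /= Gyr <-]; rewrite lerBrDr addrAC lerBlDr -mulrDr.
  have [_] := Gle _ _ (Glin 1 _ _ _ _ (real1 K) Gyr Gzs).
  rewrite scale1r mul1r => /le_trans; apply; rewrite ler_wpM2l //.
  have -> : y + z = (z + x0) + (y - x0) by rewrite addrACA subrr addr0 addrC.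
  exact: ler_normD.
have [|al [Aal alA]] := real_or_complex_sup Kroc A0 A_real.
  by exists (C * `|0 + x0| - 0); exact: ubA.
have al_real : al \is Num.real.
  by have [a Aa] := A0; rewrite -(ler_real (Aal a Aa)); exact: A_real.
exists [set p | exists y r t, [/\ G (y, r), t \is Num.real &
  p = (y + t *: x0, r + t * al)]].
split; first split.
- by exists 0, 0, 0; rewrite scale0r mul0r !addr0.
- move=> y' r' [y [r [t [Gyr t_real [-> ->]]]]].
  have [r_real rle] := Gle _ _ Gyr; split; first by rewrite realD // realM.
  have [t0|t0|<-] := real_ltgtP (real0 K) t_real; last first.
  + by rewrite scale0r mul0r !addr0.
  + have u0 : 0 < - t by rewrite oppr_gt0.
    have u_real : (- t)^-1 \is Num.real by rewrite realV realN.
    have := Aal _ (ex_intro2 _ _ _ (Glin0 _ _ _ u_real Gyr) erefl).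
    rewrite /= -(ler_pM2l u0) mulrBr mulVKf ?gt_eqF // mulrCA.
    rewrite -{1}[- t]gtr0_norm // -normrZ scalerBr scalerA mulfV ?gt_eqF //.
    rewrite scale1r scaleNr opprK mulNr => h.
    by rewrite -lerBrDr -lerBlDl.
  + have u_real : t^-1 \is Num.real by rewrite realV.
    have := alA _ (ubA _ _ (Glin0 _ _ _ u_real Gyr)).
    rewrite -(ler_pM2l t0) mulrBr mulVKf ?gt_eqF // mulrCA.
    rewrite -{2}[t]gtr0_norm // -normrZ scalerDr scalerA mulfV ?gt_eqF //.
    by rewrite scale1r lerBrDl.
- move=> t y' r' z' s' t_real [y [r [u [Gyr u_real [-> ->]]]]].
  move=> [z [s [v [Gzs v_real [-> ->]]]]].
  exists (y + t *: z), (r + t * s), (u + t * v); split.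
  + exact: Glin.
  + by rewrite realD // realM.
  + by congr pair; [rewrite scalerDr scalerDl scalerA addrACA|ring].
- by move=> [y r] Gyr; exists y, r, 0; rewrite scale0r mul0r !addr0 real0; split.
- by exists (0 + 1 * al), 0, 0, 1; split; rewrite ?real1 ?scale1r ?add0r.
Qed.

(** Zorn's lemma is applied to the sets [G] for which [G0 `|` G] is a graph: the
    empty chain then causes no exception. *)
Lemma maximal_real_functional_graph (G0 : set (E * K)) :
  real_functional_graph G0 -> exists G,
    [/\ real_functional_graph G, G0 `<=` G & forall x, exists r, G (x, r)].
Proof.
move=> G0P.
have [|A [AP Amax]] :=
    @Zorn_bigcup _ [set G | real_functional_graph (G0 `|` G)].
  move=> F FP Ftot.
  have common p q : (G0 `|` \bigcup_(X in F) X) p ->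
      (G0 `|` \bigcup_(X in F) X) q -> exists X,
      [/\ real_functional_graph X, X `<=` G0 `|` \bigcup_(X in F) X, X p & X q].
    have GX X : F X -> G0 `|` X `<=` G0 `|` \bigcup_(X in F) X.
      by move=> FX; apply: setUS; exact: bigcup_sup.
    move=> [G0p|[X FX Xp]] [G0q|[Y FY Yq]].
    - by exists G0; split=> // z; left.
    - by exists (G0 `|` Y); split; [exact: FP|exact: GX|left|right].
    - by exists (G0 `|` X); split; [exact: FP|exact: GX|right|left].
    - have [XY|YX] := Ftot X Y FX FY.
        exists (G0 `|` Y); split; [exact: FP|exact: GX|right|by right].
        exact: XY.
      exists (G0 `|` X); split; [exact: FP|exact: GX|by right|right].
      exact: YX.
  split.
  - by left; case: G0P.
  - by move=> x r xr; have [X [[_ Xle _] _ Xxr _]] := common _ _ xr xr; exact: Xle.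
  - move=> t x r y s t_real xr ys.
    have [X [[_ _ Xlin] Xsub Xxr Xys]] := common _ _ xr ys.
    by apply: Xsub; exact: Xlin.
exists (G0 `|` A); split=> // x.
have [G' [G'P AG' [r G'xr]]] := extend_real_functional_graph x AP.
exists r; right; apply: contrapT => NA.
have G0G' : G0 `|` G' = G' by apply/setUidPr => z ?; apply: AG'; left.
apply: (Amax G'); last by rewrite /= G0G'.
split; first by move=> z Az; apply: AG'; right.
by move=> /(_ _ G'xr).
Qed.

Lemma real_hahn_banach (G0 : set (E * K)) :
  real_functional_graph G0 -> exists f : E -> K,
    [/\ forall x, f x \is Num.real,
        forall t x y, t \is Num.real -> f (x + t *: y) = f x + t * f y,
        forall x, `|f x| <= C * `|x| &
        forall x r, G0 (x, r) -> f x = r].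
Proof.
move=> /maximal_real_functional_graph[G [[G00 Gle Glin] G0G /choice[f fG]]].
have Guniq_le x r s : G (x, r) -> G (x, s) -> r <= s.
  move=> Gxr Gxs; have N1 : -1 \is @Num.real K by rewrite realN real1.
  have [_] := Gle _ _ (Glin (-1) _ _ _ _ N1 Gxr Gxs).
  by rewrite scaleN1r subrr normr0 mulr0 mulN1r subr_le0.
have Guniq x r s : G (x, r) -> G (x, s) -> r = s.
  by move=> Gxr Gxs; apply/le_anti/andP; split; [exact: Guniq_le Gxr Gxs|exact: Guniq_le Gxs Gxr].
have f_real x : f x \is Num.real by have [] := Gle _ _ (fG x).
have flin t x y : t \is Num.real -> f (x + t *: y) = f x + t * f y.
  by move=> t_real; apply: Guniq (fG _) _; exact: Glin.
exists f; split=> // [x|x r /G0G]; last exact: Guniq (fG x).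
rewrite real_ler_norml //; have [_ ->] := Gle _ _ (fG x); rewrite andbT.
rewrite lerNl; have [_] := Gle _ _ (fG (0 + (-1) *: x)).
rewrite flin ?realN ?real1 // mulN1r add0r scaleN1r normrN.
by rewrite (Guniq _ _ _ (fG 0) G00) add0r.
Qed.

(** A functional is recovered from its real part [f] as
    [fun x => f x - i * f (i * x)]; the factor 2 avoids rotating the
    argument. *)
Lemma hahn_banach (V : lmodType K) (J : {linear V -> E}) (g : V -> K) :
  scalar g -> (forall v, `|g v| <= C * `|J v|) ->
  exists phi : E -> K,
    [/\ scalar phi, forall x, `|phi x| <= 2 * C * `|x| &
        forall v, phi (J v) = g v].
Proof.
move=> glin gC; have [c [re reP]] := real_or_complex_real_part Kroc.
have re_real := real_part_real reP.
have g0 : g 0 = 0.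
  by have := glin (-1) 0 0; rewrite scaler0 addr0 mulN1r addNr.
have gZ a v : g (a *: v) = a * g v by have := glin a v 0; rewrite g0 !addr0.
pose G0 : set (E * K) := [set p | exists v, p = (J v, re (g v))].
have re0 : re 0 = 0.
  by have := real_partM reP 0 (real0 K); rewrite !mul0r.
have [|f [f_real flin fC fG0]] := @real_hahn_banach G0.
  split.
  - by exists 0; rewrite linear0 g0 re0.
  - move=> x r [v [-> ->]]; split; first exact: re_real.
    apply: le_trans (real_ler_norm (re_real _)) _.
    by apply: le_trans (real_part_le reP _) _.
  - move=> t x r y s t_real [v [-> ->]] [w [-> ->]].
    exists (v + t *: w); rewrite linearD linearZ /= [v + _]addrC glin addrC.
    by rewrite (real_partD reP) (real_partM reP) // [_ + re (g v)]addrC.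
have f0 : f 0 = 0.
  by have := flin (-1) 0 0; rewrite scaler0 addr0 mulN1r subrr; apply; rewrite realN real1.
have fD x y : f (x + y) = f x + f y.
  by have := flin 1 x y (real1 K); rewrite scale1r mul1r.
have fZ t x : t \is Num.real -> f (t *: x) = t * f x.
  by move=> t_real; have := flin t 0 x t_real; rewrite f0 !add0r.
have fN x : f (- x) = - f x.
  by rewrite -scaleN1r fZ ?mulN1r // realN real1.
have faE a x : f (a *: x) = re a * f x - re (c * a) * f (c *: x).
  rewrite {1}(real_partE reP a) scalerBl fD fN fZ //.
  by rewrite (mulrC c) -scalerA fZ.
exists (fun x => f x - c * f (c *: x)); split.
- move=> a x y; have aE := real_partE reP a.
  have cax : c *: (a *: x) = a *: (c *: x) by rewrite !scalerA mulrC.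
  rewrite scalerDr !fD cax (faE a x) (faE a (c *: x)).
  move: aE; set p := re a; set q := re (c * a) => ->; rewrite scalerA.
  have [->|cc] := real_part_unit reP; first by rewrite !(mul0r, scale0r, f0); ring.
  rewrite cc scaleN1r fN; apply/eqP; rewrite -subr_eq0; apply/eqP.
  set u := f x; set v := f (c *: x).
  transitivity (- (q * v) * (c * c + 1)); first by ring.
  by rewrite cc addNr mulr0.
- move=> x; have c1 := real_part_unit_le reP.
  apply: le_trans (ler_normB _ _) _; rewrite -mulrA mulr_natl mulr2n.
  apply: lerD; first exact: fC.
  rewrite normrM; apply: (@le_trans _ _ `|f (c *: x)|); first by rewrite ler_piMl.
  apply: le_trans (fC _) _; rewrite ler_wpM2l // normrZ ler_piMl //.
- move=> v; rewrite -linearZ /= (fG0 (J v) (re (g v))); last by exists v.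
  rewrite (fG0 (J (c *: v)) (re (g (c *: v)))); last by exists (c *: v).
  by rewrite gZ -(real_partE reP).
Qed.

End HahnBanach.

(** * Null sequences *)

Section NullSequenceTools.
Variable K : numFieldType.
Implicit Types (a b : c0 K).

Lemma c0_coord_le a n : `|a n| <= `|a|.
Proof. by have [m /= mE /(_ n)] := c0_norm_attained a; rewrite -mE. Qed.

Lemma c0_norm_le a (M : K) : (forall n, `|a n| <= M) -> `|a| <= M.
Proof. by have [m /= mE _] := c0_norm_attained a => /(_ m); rewrite -mE. Qed.

Lemma null_sequenceP (f : nat -> K^o) :
  reflect (forall e : K, 0 < e -> exists N, forall n, (N <= n)%N -> `|f n| < e)
          (f \in @null_sequence K).
Proof.
apply: (iffP (asboolP _)).
  move=> /cvgrPdist_lt f0 e /f0[N _ fN]; exists N => n Nn.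
  by have := fN n Nn; rewrite /= sub0r normrN.
move=> f0; apply/cvgrPdist_lt => e /f0[N fN]; exists N => // n Nn /=.
by rewrite sub0r normrN; exact: fN.
Qed.

Lemma c0_tail a (e : K) : 0 < e ->
  exists N, forall n, (N <= n)%N -> `|a n| < e.
Proof. by move: e; apply/null_sequenceP; exact: c0_valP. Qed.

Lemma c0D_coord a b n : (a + b) n = a n + b n. Proof. by []. Qed.
Lemma c0N_coord a n : (- a) n = - a n. Proof. by []. Qed.
Lemma c0Z_coord (t : K) a n : (t *: a) n = t * a n. Proof. by []. Qed.

Lemma c0_ext a b : (forall n, a n = b n) -> a = b.
Proof. by move=> ab; apply/val_inj/funext. Qed.

End NullSequenceTools.

(** * Complementation of c0 in separable spaces *)

Definition linear_of (K : numFieldType) (V W : lmodType K) (f : V -> W)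
    (f_lin : linear f) : {linear V -> W} :=
  HB.pack_for {linear V -> W} f (GRing.isLinear.Build K V W *:%R f f_lin).

Lemma linear_ofE (K : numFieldType) (V W : lmodType K) (f : V -> W)
    (f_lin : linear f) x : linear_of f_lin x = f x.
Proof. by []. Qed.

Lemma separable_dense_sequence (K : numFieldType) (E : normedModType K) :
  separable E -> exists d : nat -> E,
    forall x e, 0 < e -> exists i, `|x - d i| < e.
Proof.
move=> [D [/countable_injP[f f_inj] Ddense]].
have [d dP] : exists d : nat -> E, forall x, D x -> exists i, d i = x.
  exists (fun i => xget 0 [set x | D x /\ f x = i]) => x Dx; exists (f x).
  by apply: xget_unique => // y [Dy fyx]; apply: f_inj => //; exact: mem_set.
exists d => x e e0; have [y [xy /dP[i di]]] : ball x e `&` D !=set0.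
  by apply: Ddense; [exists x; exact: ballxx|exact: ball_open].
by exists i; rewrite di; move: xy; rewrite -ball_normE.
Qed.

Section Sobczyk.
Variables (K : numFieldType) (Kroc : real_or_complex K) (E : normedModType K).
Variables (d : nat -> E) (J : {linear c0 K -> E}) (C : K).
Hypothesis d_dense : forall x e, 0 < e -> exists i, `|x - d i| < e.
Hypothesis C_ge0 : 0 <= C.
Hypothesis J_below : forall a, `|a| <= C * `|J a|.

Let B : K := 2 * C.

Let B0 : 0 <= B. Proof. by rewrite mulr_ge0. Qed.

(** The weak-star compact set of functionals that vanish on the copy of [c0]
    and satisfy the bound of the extended coordinate functionals. *)
Definition annihilator (psi : E -> K) : Prop :=
  [/\ scalar psi, forall y, `|psi y| <= B * `|y| & forall a, psi (J a) = 0].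

Lemma coordinate_functionals : exists phi : nat -> E -> K,
  forall n, [/\ scalar (phi n), forall y, `|phi n y| <= B * `|y| &
    forall a, phi n (J a) = a n].
Proof.
suff /choice[phi phiP] : forall n, exists phi : E -> K,
    [/\ scalar phi, forall y, `|phi y| <= B * `|y| & forall a, phi (J a) = a n].
  by exists phi.
move=> n; apply: (hahn_banach Kroc C_ge0 (g := fun a : c0 K => a n : K)) => // a.
by apply: le_trans (J_below a); exact: c0_coord_le.
Qed.

(** A weak-star cluster point of the [phi n] vanishes on [J a], because
    [phi n (J a) = a n] tends to 0. Hence [phi n] cannot stay away from the
    annihilator on finitely many vectors. *)
Lemma annihilator_approximation (phi : nat -> E -> K) :
  (forall n, [/\ scalar (phi n), forall y, `|phi n y| <= B * `|y| &
    forall a, phi n (J a) = a n]) ->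
  forall k, exists N, forall n, (N <= n)%N -> exists2 psi, annihilator psi &
    forall i, (i < k)%N -> `|phi n (d i) - psi (d i)| <= 2^-1 ^+ k.
Proof.
move=> phiP k; apply: contrapT => /forallNP far.
have {}far N : exists n, (N <= n)%N /\ ~ exists2 psi, annihilator psi &
    forall i, (i < k)%N -> `|phi n (d i) - psi (d i)| <= 2^-1 ^+ k.
  apply: contrapT => /forallNP close; apply: (far N) => n Nn.
  by apply: contrapT => fn; apply: (close n).
have [m mP] := choice far.
have [U [UU U_oo]] := @ultraFilterLemma nat \oo _.
have /choice[psi psiP] : forall x, exists l, forall e, 0 < e ->
    U [set n | `|phi (m n) x - l| <= e].
  move=> x; apply: (ultralimit Kroc UU (B := B * `|x|)) => n.
  by have [] := phiP (m n).
have psi_ann : annihilator psi.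
  split.
  - move=> a x y; apply/eqP; rewrite -subr_eq0 -normr_le0.
    apply/ler_addgt0Pr => e e0; rewrite add0r.
    have S0 : 0 < `|a| + 1 + 1 by rewrite ltr_wpDl.
    have e'0 := divr_gt0 e0 S0.
    have [n /= [h [hx hy]]] := filter_ex (filterI (psiP (a *: x + y) _ e'0)
      (filterI (psiP x _ e'0) (psiP y _ e'0))).
    have [phi_lin _ _] := phiP (m n).
    have -> : psi (a *: x + y) - (a * psi x + psi y) =
        a * (phi (m n) x - psi x) + (phi (m n) y - psi y)
        - (phi (m n) (a *: x + y) - psi (a *: x + y)).
      by rewrite phi_lin; ring.
    have -> : e = `|a| * (e / (`|a| + 1 + 1)) + e / (`|a| + 1 + 1)
        + e / (`|a| + 1 + 1).
      rewrite -{1}(divfK (lt0r_neq0 S0) e); ring.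
    apply: le_trans (ler_normB _ _) _; apply: lerD => //.
    apply: le_trans (ler_normD _ _) _; apply: lerD => //.
    by rewrite normrM ler_wpM2l.
  - move=> y; apply/ler_addgt0Pr => e e0.
    have [n /= h] := filter_ex (psiP y _ e0).
    have [_ phi_le _] := phiP (m n).
    have -> : psi y = phi (m n) y - (phi (m n) y - psi y) by ring.
    by apply: le_trans (ler_normB _ _) _; exact: lerD.
  - move=> a; apply/eqP; rewrite -normr_le0.
    apply/ler_addgt0Pr => e e0; rewrite add0r.
    have e20 : 0 < e / 2 by rewrite divr_gt0.
    have [N aN] := c0_tail a e20.
    have UN : U [set n | (N <= n)%N] by apply: U_oo; exact: nbhs_infty_ge.
    have [n /= [h Nn]] := filter_ex (filterI (psiP (J a) _ e20) UN).
    have [_ _ phiJ] := phiP (m n); move: h; rewrite phiJ => h.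
    have -> : psi (J a) = a (m n) - (a (m n) - psi (J a)) by ring.
    rewrite (splitr e); apply: le_trans (ler_normB _ _) _.
    apply: lerD => //; apply: ltW; apply: aN.
    by apply: leq_trans Nn _; have [] := mP n.
have Uk j : U [set n | forall i, (i < j)%N ->
    `|phi (m n) (d i) - psi (d i)| <= 2^-1 ^+ k].
  elim: j => [|j IH]; first by apply: filterS filterT.
  have half0 : 0 < 2^-1 ^+ k :> K by rewrite exprn_gt0 // invr_gt0.
  apply: filterS2 IH (psiP (d j) _ half0) => n /= h hj i.
  by rewrite ltnS leq_eqVlt => /predU1P[->|/h].
have [n /= h] := filter_ex (Uk k).
by have [_ []] := mP n; exists psi.
Qed.

(** Veech's argument: [phi n] minus a nearby functional [psi n] of the
    annihilator still extends the [n]-th coordinate, and tends to 0 on the dense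
    sequence, hence everywhere by equicontinuity. *)
Lemma sobczyk : exists (Q : {linear E -> c0 K}) (M : K),
  [/\ 0 <= M, forall y, `|Q y| <= M * `|y| & forall a, Q (J a) = a].
Proof.
have [phi phiP] := coordinate_functionals.
pose P k n := exists2 psi, annihilator psi &
  forall i, (i < k)%N -> `|phi n (d i) - psi (d i)| <= 2^-1 ^+ k.
have P_eventually k : exists N, forall n, (N <= n)%N -> P k n.
  exact: annihilator_approximation.
have P0 n : P 0%N n.
  exists (fun=> 0) => //; split=> // [a x y|y]; first by rewrite mulr0 addr0.
  by rewrite normr0 mulr_ge0.
(* [k n] is the largest precision, at most [n], available at [n]; it tends to
   infinity by [P_eventually]. *)
have /choice[k kP] : forall n, exists k,
    P k n /\ forall j, (j <= n)%N -> P j n -> (j <= k)%N.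
  move=> n; pose p j := (j <= n)%N && `[< P j n >].
  have ex : exists j, p j by exists 0%N; apply/andP; split=> //; exact/asboolP.
  have ub j : p j -> (j <= n)%N by case/andP.
  have [k /andP[_ /asboolP Pk] kmax] := ex_maxnP ex ub.
  by exists k; split=> // j jn Pj; apply: kmax; apply/andP; split=> //; exact/asboolP.
have /choice[psi psiP] : forall n, exists psi, annihilator psi /\
    forall i, (i < k n)%N -> `|phi n (d i) - psi (d i)| <= 2^-1 ^+ k n.
  by move=> n; have [[psi ann psi_close] _] := kP n; exists psi.
have diff_lin n : scalar (fun y => phi n y - psi n y).
  move=> a x y; have [phi_lin _ _] := phiP n.
  by have [[psi_lin _ _] _] := psiP n; rewrite phi_lin psi_lin; ring.
have diff_le n y : `|phi n y - psi n y| <= (B + B) * `|y|.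
  have [_ phi_le _] := phiP n; have [[_ psi_le _] _] := psiP n.
  by apply: le_trans (ler_normB _ _) _; rewrite mulrDl lerD.
have diffB n x y : phi n (x - y) - psi n (x - y) =
    (phi n x - psi n x) - (phi n y - psi n y).
  by rewrite (addrC x) -scaleN1r; have /= -> := diff_lin n (-1) y x; ring.
have null y : (fun n => phi n y - psi n y : K^o) \in @null_sequence K.
  apply/null_sequenceP => e e0; have e20 : 0 < e / 2 by rewrite divr_gt0.
  have BB0 : 0 < B + B + 1 by rewrite ltr_wpDl // addr_ge0.
  have [i yi] := d_dense y (divr_gt0 e20 BB0).
  have [k0 k0P] := half_powers_small Kroc e20.
  have [N NP] := P_eventually (maxn k0 i.+1).
  exists (maxn N (maxn k0 i.+1)) => n; rewrite geq_max => /andP[Nn kn].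
  have /(_ _ kn (NP n Nn)) : forall j, (j <= n)%N -> P j n -> (j <= k n)%N.
    by have [] := kP n.
  rewrite geq_max => /andP[k0k ik].
  have -> : phi n y - psi n y =
    (phi n (d i) - psi n (d i)) + (phi n (y - d i) - psi n (y - d i)).
    by rewrite diffB; ring.
  rewrite (splitr e); apply: le_lt_trans (ler_normD _ _) _; apply: ltrD.
    by have [_ /(_ i ik) /le_lt_trans] := psiP n; apply; exact: k0P.
  apply: le_lt_trans (diff_le _ _) _; move: yi; rewrite ltr_pdivlMr // mulrC.
  by apply: le_lt_trans; rewrite ler_wpM2r // lerDl.
have Q_lin : linear (fun y => C0 (null y)).
  by move=> a x y; apply: c0_ext => n; rewrite /= diff_lin.
exists (linear_of Q_lin), (B + B); split.
- by rewrite addr_ge0.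
- by move=> y; apply: c0_norm_le => n; exact: diff_le.
- move=> a; apply: c0_ext => n /=; have [_ _ ->] := phiP n.
  by have [[_ _ ->] _] := psiP n; rewrite subr0.
Qed.

End Sobczyk.

(** * A doubly power-bounded operator on c0 *)

Section BlockRotation.
Local Open Scope nat_scope.

Definition block (i : nat) : nat := 2 ^ trunc_log 2 i.

(** The indices from [2 ^ k] to [2 ^ k.+1 - 1] form the block rotated by [n]
    places; the index 0 stays fixed. *)
Definition block_rotate (n i : nat) : nat :=
  if i == 0 then 0 else block i + (i - block i + n) %% block i.

Lemma block_gt0 i : 0 < block i.
Proof. by rewrite expn_gt0. Qed.

Lemma block_le i : 0 < i -> block i <= i < block i + block i.
Proof.
move=> i0; have /andP[-> /=] := trunc_log_bounds (isT : 1 < 2) i0.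
by rewrite expnS mul2n addnn.
Qed.

Lemma block_add i k : i < 2 ^ k -> block (2 ^ k + i) = 2 ^ k.
Proof.
move=> ik; congr (2 ^ _); apply: trunc_log_eq => //.
by rewrite leq_addr expnS mul2n -addnn ltn_add2l.
Qed.

Lemma block_rotate_eq0 n i : (block_rotate n i == 0) = (i == 0).
Proof.
rewrite /block_rotate; case: (i =P 0) => // /eqP _.
by rewrite addn_eq0 gtn_eqF // block_gt0.
Qed.

Lemma block_block_rotate n i : block (block_rotate n i) = block i.
Proof.
rewrite /block_rotate; case: (i =P 0) => [->//|_].
by rewrite [block i]/(2 ^ _) block_add // ltn_mod expn_gt0.
Qed.

Lemma block_rotateD m n i :
  block_rotate m (block_rotate n i) = block_rotate (n + m) i.
Proof.
rewrite {1}/block_rotate block_rotate_eq0 block_block_rotate.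
rewrite /block_rotate; case: (i =P 0) => // _.
by rewrite addKn modnDml addnA.
Qed.

Lemma block_rotate_modn n i : block_rotate (n %% block i) i = block_rotate n i.
Proof. by rewrite /block_rotate modnDmr. Qed.

Lemma block_rotate0 i : block_rotate 0 i = i.
Proof.
rewrite /block_rotate; case: (i =P 0) => [->//|/eqP]; rewrite -lt0n => i0.
have /andP[bi ib] := block_le i0.
by rewrite addn0 modn_small ?subnKC // -(ltn_add2l (block i)) subnKC.
Qed.

Lemma iter_block_rotate n i :
  iter n (block_rotate 1) i = block_rotate n i.
Proof.
elim: n => [|n IH]; first by rewrite block_rotate0.
by rewrite iterS IH block_rotateD addn1.
Qed.

Definition block_unrotate (i : nat) : nat := block_rotate (block i).-1 i.

Lemma block_rotateK : cancel (block_rotate 1) block_unrotate.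
Proof.
move=> i; rewrite /block_unrotate block_rotateD block_block_rotate.
by rewrite add1n prednK ?block_gt0 // -block_rotate_modn modnn block_rotate0.
Qed.

Lemma block_unrotateK : cancel block_unrotate (block_rotate 1).
Proof.
move=> i; rewrite /block_unrotate block_rotateD.
by rewrite addn1 prednK ?block_gt0 // -block_rotate_modn modnn block_rotate0.
Qed.

Lemma block_ge i N : 2 ^ N <= i -> 2 ^ N <= block i.
Proof.
move=> Ni; rewrite leq_exp2l //; apply: trunc_log_max => //.
Qed.

Lemma block_rotate_proper (s : nat -> nat) N :
  exists M, forall i, M <= i -> N <= block_rotate (s i) i.
Proof.
exists (2 ^ N) => i Ni; have i0 : 0 < i by apply: leq_trans Ni; rewrite expn_gt0.
apply: leq_trans (_ : block i <= _); last first.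
  by rewrite /block_rotate gtn_eqF // leq_addr.
by apply: leq_trans (block_ge Ni); rewrite ltnW // ltn_expl.
Qed.

End BlockRotation.

Section Shear.
Variable K : numFieldType.
Variables (p : nat -> nat) (w : nat -> K).
Hypothesis p0 : p 0%N = 0%N.
Hypothesis p_proper : forall N, exists M, forall i, (M <= i)%N -> (N <= p i)%N.
Hypothesis w_null : (fun i => w (p i) - w i : K^o) \in @null_sequence K.

Lemma shear_null (a : c0 K) :
  (fun i => a (p i) + a 0%N * (w (p i) - w i) : K^o) \in @null_sequence K.
Proof.
apply/null_sequenceP => e e0; have e20 : 0 < e / 2 by rewrite divr_gt0.
have [N1 aN1] := c0_tail a e20; have [N2 pN2] := p_proper N1.
have A0 : 0 < `|a 0%N| + 1 by rewrite ltr_wpDl.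
have /null_sequenceP/(_ _ (divr_gt0 e20 A0))[N3 wN3] := w_null.
exists (maxn N2 N3) => i; rewrite geq_max => /andP[N2i N3i].
rewrite (splitr e); apply: le_lt_trans (ler_normD _ _) _; apply: ltrD.
  by apply: aN1; exact: pN2.
rewrite normrM; have := wN3 i N3i; rewrite ltr_pdivlMr // mulrC.
by apply: le_lt_trans; rewrite ler_wpM2r // lerDl.
Qed.

(** On the span of [c0] and the bounded sequence [w], composition with [p] maps
    [a + t * w] to [a \o p + t * (w \o p - w) + t * w]. Storing [t] in the
    coordinate 0, which [p] fixes, turns it into an operator on [c0] itself. *)
Lemma shear_operator : exists T : {linear c0 K -> c0 K}, forall n a i,
  iter n T a i = a (iter n p i) + a 0%N * (w (iter n p i) - w i).
Proof.
pose F a := C0 (shear_null a).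
have FE a i : F a i = a (p i) + a 0%N * (w (p i) - w i) by [].
have F_lin : linear F.
  move=> t a b; apply: c0_ext => i; rewrite c0D_coord c0Z_coord !FE.
  by rewrite !(c0D_coord, c0Z_coord); ring.
exists (linear_of F_lin); elim=> [|n IH] a i; first by rewrite /= subrr mulr0 addr0.
have pn0 : iter n p 0%N = 0%N by elim: n {IH} => //= n ->.
rewrite iterS linear_ofE FE !IH pn0 -iterSr; ring.
Qed.

End Shear.

Section Counterexample.
Variables (K : numFieldType) (Kroc : real_or_complex K).

(** A tent on each block, so that rotating by one place moves the values by at
    most [2 / block i], while rotating by half a block takes the value 1 at the
    start of the block to 0. *)
Definition tent (b j : nat) : K := `|2 * j%:R / b%:R - 1|.

Definition block_tent (i : nat) : K :=
  if i == 0%N then 0 else tent (block i) (i - block i).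

Lemma tent_le1 b j : (0 < b)%N -> (j <= b)%N -> `|tent b j| <= 1.
Proof.
move=> b0 jb; have b0' : 0 < b%:R :> K by rewrite ltr0n.
have j_real : 2 * j%:R / b%:R \is @Num.real K.
  by rewrite ger0_real // divr_ge0 // mulr_ge0.
rewrite normr_id real_ler_norml ?realB ?real1 // lerBrDl subrr.
rewrite divr_ge0 ?mulr_ge0 //= lerBlDl ler_pdivrMr //.
by rewrite -natr1 -[1 + 1]/(2%:R) ler_wpM2l // ler_nat.
Qed.

Lemma tent_step b j : (0 < b)%N -> `|tent b j.+1 - tent b j| <= 2 / b%:R.
Proof.
move=> b0; have b0' : 0 < b%:R :> K by rewrite ltr0n.
apply: le_trans (ler_dist_dist _ _) _.
have -> : 2 * j.+1%:R / b%:R - 1 - (2 * j%:R / b%:R - 1) = 2 / b%:R :> K.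
  by rewrite -natr1; ring.
by rewrite ger0_norm // divr_ge0.
Qed.

Lemma tent_mod b j : (0 < b)%N -> (j <= b)%N -> tent b (j %% b) = tent b j.
Proof.
move=> b0; rewrite leq_eqVlt => /predU1P[->|jb]; last by rewrite modn_small.
rewrite modnn /tent mulr0 mul0r sub0r normrN mulfK ?pnatr_eq0 ?gtn_eqF //.
by congr `|_|; ring.
Qed.

Lemma block_tent_le1 i : `|block_tent i| <= 1.
Proof.
rewrite /block_tent; case: (i =P 0%N) => [_|/eqP]; first by rewrite normr0.
rewrite -lt0n => i0; have /andP[bi ib] := block_le i0.
apply: tent_le1; first exact: block_gt0.
by rewrite ltnW // -(ltn_add2l (block i)) subnKC.
Qed.

Lemma block_tent_step i :
  `|block_tent (block_rotate 1 i) - block_tent i| <= 2 / (block i)%:R.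
Proof.
rewrite /block_tent block_rotate_eq0; case: (i =P 0%N) => [_|/eqP].
  by rewrite subrr normr0 divr_ge0.
rewrite -lt0n => i0; have /andP[bi ib] := block_le i0.
rewrite block_block_rotate /block_rotate gtn_eqF // addKn addn1.
rewrite tent_mod ?block_gt0 //; first exact: tent_step (block_gt0 i).
by rewrite -(ltn_add2l (block i)) subnKC.
Qed.

Lemma block_large (e : K) : 0 < e ->
  exists N, forall i, (2 ^ N <= i)%N -> 2 / (block i)%:R < e.
Proof.
move=> e0; have [N hN] := half_powers_small Kroc (divr_gt0 e0 (ltr0n K 2)).
exists N => i /block_ge; rewrite /block leq_exp2l // => /hN.
by rewrite ltr_pdivlMr // natrX exprVn mulrC.
Qed.

Lemma block_tent_null :
  (fun i => block_tent (block_rotate 1 i) - block_tent i : K^o)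
    \in @null_sequence K.
Proof.
apply/null_sequenceP => e /block_large[N hN]; exists (2 ^ N)%N => i /hN.
by apply: le_lt_trans; exact: block_tent_step.
Qed.

Lemma block_tent_unrotate_null :
  (fun i => block_tent (block_unrotate i) - block_tent i : K^o)
    \in @null_sequence K.
Proof.
apply/null_sequenceP => e e0.
have /null_sequenceP/(_ e e0)[N hN] := block_tent_null.
have [M hM] := block_rotate_proper (fun i => (block i).-1) N.
exists M => i /hM /hN; rewrite -/(block_unrotate i) block_unrotateK.
by rewrite distrC.
Qed.

Lemma shear_bound (T : c0 K -> c0 K) (p : nat -> nat) :
  (forall n a i, iter n T a i =
     a (iter n p i) + a 0%N * (block_tent (iter n p i) - block_tent i)) ->
  forall n a, `|iter n T a| <= 3 * `|a|.
Proof.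
move=> TE n a; apply: c0_norm_le => i; rewrite TE.
have -> : 3 * `|a| = `|a| + `|a| * (1 + 1) by ring.
apply: le_trans (ler_normD _ _) _; apply: lerD; first exact: c0_coord_le.
rewrite normrM; apply: ler_pM => //; first exact: c0_coord_le.
by apply: le_trans (ler_normB _ _) _; apply: lerD; exact: block_tent_le1.
Qed.

(** The vector is the 0-th unit vector, which stands for [block_tent]. The
    differences of its orbit are the rotations of one sequence that tends to 0;
    on finitely many blocks these are periodic, so they are totally bounded.
    The orbit is not, as it has coordinates of modulus 1 arbitrarily far out. *)
Lemma c0_counterexample : exists (T S : {linear c0 K -> c0 K}) (x : c0 K),
  [/\ cancel T S /\ cancel S T,
      forall n a, `|iter n T a| <= 3 * `|a|,
      forall n a, `|iter n S a| <= 3 * `|a|,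
      totally_bounded (range (fun n => iter (n + 1) T x - iter n T x)) &
      forall N, exists n i, (N <= i)%N /\ `|iter n T x i| = 1].
Proof.
have r0 : block_rotate 1 0 = 0%N by [].
have u0 : block_unrotate 0 = 0%N by [].
have [T TE] := shear_operator r0 (block_rotate_proper (fun=> 1%N)) block_tent_null.
have [S SE] := shear_operator u0 (block_rotate_proper (fun i => (block i).-1))
  block_tent_unrotate_null.
have T1 a i := TE 1%N a i; have S1 a i := SE 1%N a i; rewrite /= in T1 S1.
have e_null : (fun i => (i == 0%N)%:R : K^o) \in @null_sequence K.
  by apply/null_sequenceP => e e0; exists 1%N => -[//|i] _; rewrite normr0.
exists T, S, (C0 e_null); split.
- split=> a; apply: c0_ext => i.
  + by rewrite S1 !T1 block_unrotateK r0; ring.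
  + by rewrite T1 !S1 block_rotateK u0; ring.
- exact: shear_bound TE.
- exact: shear_bound SE.
- pose D n := iter (n + 1) T (C0 e_null) - iter n T (C0 e_null).
  have DE n i : D n i = block_tent (block_rotate 1 (block_rotate n i))
      - block_tent (block_rotate n i).
    rewrite /D c0D_coord c0N_coord !TE !iter_block_rotate /=.
    by rewrite !block_rotate_eq0 block_rotateD; ring.
  move=> e e0; have e20 : 0 < e / 2 by rewrite divr_gt0.
  have [N hN] := block_large (divr_gt0 e20 (ltr0n K 2)).
  exists [seq D n | n <- iota 0 (2 ^ N)] => _ [n _ <-].
  exists (D (n %% 2 ^ N)%N).
    by apply: map_f; rewrite mem_iota ltn_mod expn_gt0.
  apply: (@le_lt_trans _ _ (e / 2)); last by rewrite gtr_pMr // invf_lt1 ?ltr1n.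
  apply: c0_norm_le => i; rewrite c0D_coord c0N_coord !DE.
  have [iN|Ni] := ltnP i (2 ^ N).
    rewrite -(block_rotate_modn (n %% _)) modn_dvdm ?block_rotate_modn.
      by rewrite subrr normr0 ltW.
    have [->|i0] := posnP i; first exact: dvd1n.
    rewrite dvdn_exp2l // -(@leq_exp2l 2) // ltnW //.
    by apply: leq_ltn_trans iN; have /andP[] := block_le i0.
  rewrite [leRHS]splitr; apply: le_trans (ler_normB _ _) _.
  by apply: lerD; apply: le_trans (block_tent_step _) _;
    rewrite block_block_rotate ltW // hN.
- move=> N; exists (2 ^ N)%N, (2 ^ N.+1)%N.
  split; first by rewrite ltnW // (ltn_trans (ltnSn N)) // ltn_expl.
  have bE : block (2 ^ N.+1) = (2 ^ N.+1)%N.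
    by rewrite -{1}[(2 ^ N.+1)%N]addn0 block_add // expn_gt0.
  have lt : (2 ^ N < 2 ^ N.+1)%N by rewrite ltn_exp2l.
  have nz k : (2 ^ k == 0)%N = false by rewrite gtn_eqF // expn_gt0.
  rewrite TE iter_block_rotate /= block_rotate_eq0 nz mul1r add0r.
  rewrite /block_tent block_rotate_eq0 nz block_block_rotate.
  rewrite /block_rotate nz bE subnn add0n addKn modn_small // /tent.
  have -> : 2 * (2 ^ N)%:R = (2 ^ N.+1)%:R :> K by rewrite expnS natrM.
  by rewrite divff ?pnatr_eq0 ?nz // mulr0 mul0r subrr normr0 !sub0r !normrN !normr1.
Qed.

End Counterexample.

(** * Copies of c0 from bounded subset sums *)

Section Blocks.
Variables (K : numFieldType) (E : normedModType K).

(** [unit_combination x m n v]: [v] combines [x m], ..., [x n.-1] with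
    coefficients in the unit disc. *)
Definition unit_combination (x : nat -> E) (m n : nat) (v : E) : Prop :=
  exists a : nat -> K, [/\ forall i, `|a i| <= 1,
    forall i, ~~ (m <= i < n)%N -> a i = 0 & v = \sum_(i < n) a i *: x i].

Definition bounded_subset_sums (x : nat -> E) (B : K) : Prop :=
  forall n (A : pred nat), `|\sum_(i < n | A i) x i| <= B.

(** The norm is convex in each [t i] separately, so it is largest when every
    [t i] is 0 or 1. *)
Lemma convex_combination_le (x : nat -> E) (B : K) n (t : nat -> K) (v : E) :
  (forall i, 0 <= t i <= 1) ->
  (forall A : pred nat, `|v + \sum_(i < n | A i) x i| <= B) ->
  `|v + \sum_(i < n) t i *: x i| <= B.
Proof.
move=> t01; elim: n v => [|n IH] v vB.
  by have := vB xpred0; rewrite !big_ord0.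
rewrite big_ord_recr /=; set s := \sum_(i < n) _.
have /andP[t0 t1] := t01 n.
have -> : v + (s + t n *: x n) = (1 - t n) *: (v + s) + t n *: (v + x n + s).
  by rewrite (addrAC v (x n)) (scalerDr (t n)) !addrA -scalerDl subrK scale1r.
have -> : B = (1 - t n) * B + t n * B by rewrite -mulrDl subrK mul1r.
have t1' : 0 <= 1 - t n by rewrite subr_ge0.
have sub (A : pred nat) : \sum_(i < n.+1 | A i && (i != n :> nat)) x i = \sum_(i < n | A i) x i.
  rewrite big_mkcond big_ord_recr /= eqxx andbF addr0 [RHS]big_mkcond /=.
  by apply: eq_bigr => i _; rewrite neq_ltn ltn_ord andbT.
apply: le_trans (ler_normD _ _) _; apply: lerD; rewrite normrZ ger0_norm //;
  apply: ler_wpM2l => //; apply: IH => A.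
  by rewrite -sub; exact: (vB [pred i | A i && (i != n)]).
have := vB [pred i | A i || (i == n)]; rewrite [X in _ + X]big_mkcond big_ord_recr /=.
rewrite eqxx orbT addrA addrAC; congr (`|_ + _ + _| <= _).
rewrite [RHS]big_mkcond; apply: eq_bigr => i _ /=.
by rewrite ltn_eqF ?orbF.
Qed.

Section Combinations.
Variable x : nat -> E.

Lemma unit_combination0 m n : unit_combination x m n 0.
Proof.
exists (fun=> 0); split=> // [i|]; first by rewrite normr0.
by rewrite big1 // => i _; rewrite scale0r.
Qed.

Lemma unit_combination1 n : unit_combination x n n.+1 (x n).
Proof.
exists (fun i => (i == n)%:R); split=> [i|i|].
- by case: eqP => _; rewrite ?normr1 ?normr0.
- by rewrite ltnS -eqn_leq eq_sym => /negbTE ->.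
rewrite big_ord_recr /= eqxx scale1r big1 ?add0r // => i _.
by rewrite ltn_eqF // scale0r.
Qed.

Lemma unit_combinationZ m n c v : `|c| <= 1 ->
  unit_combination x m n v -> unit_combination x m n (c *: v).
Proof.
move=> c1 [a [a1 a0 ->]]; exists (fun i => c * a i); split=> [i|i /a0 ->|].
- by rewrite normrM; apply: mulr_ile1.
- by rewrite mulr0.
by rewrite scaler_sumr; apply: eq_bigr => i _; rewrite scalerA.
Qed.

Lemma unit_combinationD m n p u v : (m <= n <= p)%N ->
  unit_combination x m n u -> unit_combination x n p v ->
  unit_combination x m p (u + v).
Proof.
move=> /andP[mn np] [a [a1 a0 ->]] [b [b1 b0 ->]].
exists (fun i => a i + b i); split=> [i|i ip|].
- have [i_n|n_i] := ltnP i n.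
    by rewrite (b0 i) ?addr0 // leqNgt i_n.
  by rewrite (a0 i) ?add0r // ltnNge n_i andbF.
- rewrite a0 ?b0 ?addr0 //; apply: contra ip => /andP[h1 h2].
    by rewrite (leq_trans mn h1).
  by rewrite h1 (leq_trans h2 np).
under [RHS]eq_bigr do rewrite scalerDl.
rewrite big_split /=; congr (_ + _).
rewrite (big_ord_widen _ (fun i => a i *: x i) np) big_mkcond /=.
by apply: eq_bigr => i _; case: ltnP => // ni; rewrite a0 ?scale0r // ltnNge ni andbF.
Qed.

Lemma unit_combinationW m n m' n' v : (m <= m')%N -> (n' <= n)%N ->
  unit_combination x m' n' v -> unit_combination x m n v.
Proof.
move=> mm' n'n [a [a1 a0 ->]]; exists a; split=> // [i|].
  move=> imn; apply: a0; apply: contra imn => /andP[h1 h2].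
  by rewrite (leq_trans mm' h1) (leq_trans h2 n'n).
rewrite (big_ord_widen _ (fun i => a i *: x i) n'n) big_mkcond /=.
by apply: eq_bigr => i _; case: ltnP => // ni; rewrite a0 ?scale0r // ltnNge ni andbF.
Qed.

End Combinations.

(** A scalar of modulus at most 1 is [t1 - t2 - c * (t3 - t4)] with the [t j]
    in the unit interval; whence the factor 4. *)
Lemma unit_combination_bound (x : nat -> E) (B : K) m n v :
  real_or_complex K -> bounded_subset_sums x B ->
  unit_combination x m n v -> `|v| <= 4 * B.
Proof.
move=> Kroc xB [a [a1 _ ->]]; have [c [re reP]] := real_or_complex_real_part Kroc.
have c1 := real_part_unit_le reP.
have pos (t : nat -> K) : (forall i, 0 <= t i <= 1) ->
    `|\sum_(i < n) t i *: x i| <= B.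
  move=> t01; rewrite -[X in `|X|]add0r; apply: convex_combination_le => // A.
  by rewrite add0r; exact: xB.
have real (t : nat -> K) : (forall i, t i \is Num.real /\ `|t i| <= 1) ->
    `|\sum_(i < n) t i *: x i| <= B + B.
  move=> tP; have -> : \sum_(i < n) t i *: x i =
      \sum_(i < n) ((`|t i| + t i) / 2) *: x i -
      \sum_(i < n) ((`|t i| - t i) / 2) *: x i.
    rewrite -sumrB; apply: eq_bigr => i _; rewrite -scalerBl; congr (_ *: _).
    by field.
  apply: le_trans (ler_normB _ _) _; apply: lerD.
    apply: (pos (fun i => (`|t i| + t i) / 2)) => i; have [t_real t1] := tP i.
    have tN := real_lerNnormlW t_real (lexx _); rewrite lerNl -subr_ge0 opprK in tN.
    rewrite divr_ge0 //= ler_pdivrMr // mul1r -[2]/(1 + 1) lerD //.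
    exact: le_trans (real_ler_norm t_real) t1.
  apply: (pos (fun i => (`|t i| - t i) / 2)) => i; have [t_real t1] := tP i.
  rewrite divr_ge0 ?subr_ge0 ?real_ler_norm //= ler_pdivrMr // mul1r -[2]/(1 + 1).
  by rewrite lerD // lerNl; apply: real_lerNnormlW t_real _.
have -> : \sum_(i < n) a i *: x i = \sum_(i < n) re (a i) *: x i -
    c *: \sum_(i < n) re (c * a i) *: x i.
  rewrite scaler_sumr -sumrB; apply: eq_bigr => i _.
  by rewrite scalerA -scalerBl -(real_partE reP).
have -> : 4 * B = (B + B) + (B + B) by ring.
apply: le_trans (ler_normB _ _) _; apply: lerD.
  apply: (real (fun i => re (a i))) => i; split; first exact: real_part_real reP _.
  by apply: le_trans (a1 i); exact: real_part_le reP _.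
rewrite normrZ; apply: le_trans (ler_piMl _ c1) _ => //.
apply: (real (fun i => re (c * a i))) => i; split; first exact: real_part_real reP _.
apply: le_trans (real_part_le reP _) _; rewrite normrM.
by apply: mulr_ile1.
Qed.

(** The first half asks that the map from finitely supported sequences to
    combinations of [u] has norm at most [b]; the second that its inverse has
    norm at most [2 / b]. *)
Definition c0_like (u : nat -> E) (b : K) : Prop :=
  (forall r (c : nat -> K) be, 0 <= be -> (forall k, (k < r)%N -> `|c k| <= be) ->
     `|\sum_(k < r) c k *: u k| <= b * be) /\
  (forall r (c : nat -> K) i, (i < r)%N ->
     b / 2 * `|c i| <= `|\sum_(k < r) c k *: u k|).

(** The best bounds for unit combinations of the tails decrease to a positive
    limit; [b] replaces that limit up to the factor 3/4. If no [b] existed, any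
    bound could be multiplied by 3/4, and iteration would contradict
    [e <= `|x i|]. *)
Lemma james_constant (x : nat -> E) (B e : K) :
  real_or_complex K -> 0 < e -> (forall i, e <= `|x i|) ->
  (forall m n v, unit_combination x m n v -> `|v| <= B) ->
  exists b N, [/\ 0 < b,
    forall m n v, (N <= m)%N -> unit_combination x m n v -> `|v| <= b &
    forall m, (N <= m)%N -> exists n v,
      [/\ (m <= n)%N, unit_combination x m n v & 3 / 4 * b < `|v|]].
Proof.
move=> Kroc e0 xe xB; pose q : K := 3 / 4.
have q01 : 0 <= q < 1.
  by rewrite divr_ge0 //= ltr_pdivrMr // mul1r ltr_nat.
apply: contrapT => none.
have B0 : 0 <= B by apply: le_trans (xB _ _ _ (unit_combination0 x 0 0)).
have tail_bound k : exists N, forall m n v, (N <= m)%N ->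
    unit_combination x m n v -> `|v| <= B * q ^+ k.
  elim: k => [|k [N bound]]; first by exists 0%N => m n v _; rewrite mulr1; exact: xB.
  have b_ge : e <= B * q ^+ k.
    by apply: le_trans (xe N) (bound N N.+1 _ _ _) => //; exact: unit_combination1.
  have b0 := lt_le_trans e0 b_ge.
  apply: contrapT => /forallNP big; apply: none; exists (B * q ^+ k), N.
  split=> // m Nm; apply: contrapT => small; apply: (big m) => m' n v mm' vP.
  rewrite exprSr mulrA mulrC real_leNgt ?normr_real //; last first.
    by rewrite gtr0_real // pmulr_lgt0 // divr_gt0.
  apply/negP => vq; apply: small; exists (maxn m n), v; split=> //.
    exact: leq_maxl.
  by apply: unit_combinationW vP => //; exact: leq_maxr.
have [N small] := geometric_lt Kroc q01 e0 (ger0_real B0).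
have [m bound] := tail_bound N.
have := le_lt_trans (bound m m.+1 _ (leqnn m) (unit_combination1 x m)) (small N (leqnn N)).
by move=> /(le_lt_trans (xe m)); rewrite ltxx.
Qed.

(** James's distortion argument. Let [u k] be successive blocks with
    [3 / 4 * b < `|u k|] and let [v] be a combination of them whose largest
    coefficient is [c j]. Changing the sign of all other coefficients gives [v']
    with [v + v' = 2 *: (c j *: u j)] and [`|v'| <= b * `|c j|], so
    [`|v| >= (3 / 2 - 1) * b * `|c j|]. *)
Lemma james_blocks (x : nat -> E) (B e : K) :
  real_or_complex K -> 0 < e -> (forall i, e <= `|x i|) ->
  bounded_subset_sums x B -> exists u b, 0 < b /\ c0_like u b.
Proof.
move=> Kroc e0 xe xB.
have [m n v|b [N [b0 bound large]]] := @james_constant x (4 * B) e Kroc e0 xe.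
  exact: unit_combination_bound.
have /choice[g gP] : forall m, exists p : nat * E, (N <= m)%N ->
    [/\ (m <= p.1)%N, unit_combination x m p.1 p.2 & 3 / 4 * b < `|p.2|].
  move=> m; have [/large[n [v [mn vP vb]]]|_] := leqP N m.
    by exists (n, v).
  by exists (0%N, 0).
pose s k := iter k (fun m => (g m).1) N.
have Ns k : (N <= s k)%N.
  elim: k => [|k IH]; first exact: leqnn.
  by apply: leq_trans (IH) _; have [] := gP (s k) IH.
pose u k := (g (s k)).2.
have uP k : unit_combination x (s k) (s k.+1) (u k) by have [] := gP _ (Ns k).
have u_large k : 3 / 4 * b < `|u k| by have [] := gP _ (Ns k).
have unit_sum r (c : nat -> K) : (forall k, (k < r)%N -> `|c k| <= 1) ->
    unit_combination x N (s r) (\sum_(k < r) c k *: u k).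
  elim: r => [|r IH] c1; first by rewrite big_ord0; exact: unit_combination0.
  rewrite big_ord_recr /=; apply: (@unit_combinationD x N (s r)).
  - by rewrite Ns /=; have [] := gP _ (Ns r).
  - by apply: IH => k kr; apply: c1; rewrite ltnW.
  - by apply: unit_combinationZ (uP r); exact: c1.
have upper r (c : nat -> K) be : 0 <= be ->
    (forall k, (k < r)%N -> `|c k| <= be) ->
    `|\sum_(k < r) c k *: u k| <= b * be.
  rewrite le_eqVlt => /predU1P[<-|be0] cbe.
    rewrite mulr0 big1 ?normr0 // => k _.
    by have := cbe k (ltn_ord k); rewrite normr_le0 => /eqP ->; rewrite scale0r.
  have -> : \sum_(k < r) c k *: u k = be *: \sum_(k < r) (c k / be) *: u k.
    rewrite scaler_sumr; apply: eq_bigr => k _.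
    by rewrite scalerA mulrC divfK // gt_eqF.
  rewrite normrZ gtr0_norm // mulrC ler_pM2r //.
  apply: (bound N (s r)) => //; apply: (unit_sum r (fun k => c k / be)) => k kr.
  by rewrite normrM normfV (gtr0_norm be0) ler_pdivrMr // mul1r cbe.
exists u, b; split=> //; split=> // r c i ir.
have [j [jr cj]] : exists j, (j < r)%N /\ forall k, (k < r)%N -> `|c k| <= `|c j|.
  elim: r i ir {unit_sum} => [|r IH] i ir; first by rewrite ltn0 in ir.
  have [r0|r0] := posnP r.
    by exists r; split=> // k; rewrite r0 ltnS leqn0 => /eqP ->.
  have [j [jr cj]] := IH 0%N r0.
  have /orP[h|h] := real_leVge (normr_real (c j)) (normr_real (c r)).
  - exists r; split=> // k; rewrite ltnS leq_eqVlt => /predU1P[->//|/cj].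
    by move=> /le_trans; apply.
  - exists j; split; first by rewrite ltnW.
    by move=> k; rewrite ltnS leq_eqVlt => /predU1P[->//|/cj].
apply: (@le_trans _ _ (b / 2 * `|c j|)).
  by rewrite ler_pM2l ?divr_gt0 //; exact: cj.
pose c' k := if k == j then c j else - c k.
have c'_le k : (k < r)%N -> `|c' k| <= `|c j|.
  by rewrite /c'; case: eqP => // _ kr; rewrite normrN cj.
have sumE : \sum_(k < r) c k *: u k =
    2 *: (c j *: u j) - \sum_(k < r) c' k *: u k.
  apply/eqP; rewrite -subr_eq opprK -big_split /= (bigD1 (Ordinal jr)) //=.
  rewrite big1 => [|k kj]; last first.
    rewrite /c' ifF ?scaleNr ?subrr //; apply/negbTE; apply: contra kj => /eqP kj.
    by apply/eqP/val_inj.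
  by rewrite addr0 /c' eqxx scaler_nat mulr2n.
have -> : b / 2 * `|c j| = 2 * (`|c j| * (3 / 4 * b)) - b * `|c j| by field.
apply: (@le_trans _ _ (`|2 *: (c j *: u j)| - `|\sum_(k < r) c' k *: u k|)).
  apply: lerB; last exact: upper.
  by rewrite !normrZ normr_nat; do 2 (apply: ler_wpM2l => //); exact: ltW.
by rewrite sumE; exact: lerB_dist.
Qed.

End Blocks.

(** * Embedding of c0 *)

Section CopyOfC0.
Variables (K : numFieldType) (Kroc : real_or_complex K).
Variable E : completeNormedModType K.
Variables (u : nat -> E) (b : K).
Hypotheses (b0 : 0 < b) (u_c0 : c0_like u b).

Let partial_sum (a : nat -> K) n : E := \sum_(i < n) a i *: u i.

Lemma c0_like_cauchy (a : c0 K) e N m n : 0 <= e ->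
  (forall i, (N <= i)%N -> `|a i| <= e) -> (N <= m <= n)%N ->
  `|partial_sum a n - partial_sum a m| <= b * e.
Proof.
move=> e0 aN /andP[Nm mn].
have -> : partial_sum a n - partial_sum a m =
    \sum_(i < n) (if (i < m)%N then 0 else a i) *: u i.
  rewrite /partial_sum (big_ord_widen _ (fun i => a i *: u i) mn).
  rewrite [X in _ - X]big_mkcond -sumrB; apply: eq_bigr => i _ /=.
  by case: ltnP => _; rewrite ?subrr ?scale0r ?subr0.
apply: (u_c0.1 n (fun i => if (i < m)%N then 0 else a i)) => // i _.
by case: ltnP => im; rewrite ?normr0 // aN // (leq_trans Nm).
Qed.

Lemma c0_like_sum (a : c0 K) : exists l : E, partial_sum a @ \oo --> l.
Proof.
suff /cauchy_cvg/cvg_ex[l al] : cauchy (partial_sum a @ \oo) by exists l.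
apply/cauchyP => e e0; have be0 : 0 < b + 1 by rewrite ltr_wpDl // ltW.
have [N aN] := c0_tail a (divr_gt0 e0 be0).
exists (partial_sum a N), N => // n Nn; rewrite -ball_normE /= distrC.
have eb0 : 0 <= e / (b + 1) by rewrite divr_ge0 // ltW.
have aN' i : (N <= i)%N -> `|a i| <= e / (b + 1) by move=> /aN /ltW.
apply: le_lt_trans (c0_like_cauchy eb0 aN' _) _; first by rewrite leqnn.
by rewrite mulrCA gtr_pMr // ltr_pdivrMr // mul1r ltrDl.
Qed.

Lemma c0_like_embedding : exists J : {linear c0 K -> E},
  forall a, `|J a| <= b * `|a| /\ b / 2 * `|a| <= `|J a|.
Proof.
have [J JP] := choice c0_like_sum.
have J_lin : linear J.
  move=> t a c; apply: (@cvg_unique _ (@norm_hausdorff _ E) _ _ _ _ (JP _)).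
  have -> : partial_sum (t *: a + c) =
      (fun n => t *: partial_sum a n + partial_sum c n).
    apply/funext => n; rewrite /partial_sum scaler_sumr -big_split.
    by apply: eq_bigr => i _; rewrite c0D_coord c0Z_coord scalerDl scalerA.
  apply: cvgD; last exact: JP.
  by apply: cvgZ; [exact: cvg_cst|exact: JP].
exists (linear_of J_lin) => a; rewrite linear_ofE; split.
- apply/ler_addgt0Pr => e e0.
  have /cvgrPdist_lt/(_ e e0)/filter_ex[n /= Jn] := JP a.
  rewrite -(subrK (partial_sum a n) (J a)) addrC.
  apply: le_trans (ler_normD _ _) _; apply: lerD (ltW Jn).
  by apply: u_c0.1 => // k _; exact: c0_coord_le.
- apply/ler_addgt0Pr => e e0; have [i aE _] := c0_norm_attained a.
  have -> : `|a| = `|a i| by [].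
  have /cvgrPdist_lt/(_ e e0) Je := JP a.
  have [n /= [Jn i_n]] := filter_ex (filterI Je (nbhs_infty_ge i.+1)).
  apply: le_trans (u_c0.2 n a i i_n) _.
  rewrite -/(partial_sum a n) -(subrK (J a) (partial_sum a n)) addrC.
  apply: le_trans (ler_normD _ _) _; apply: lerD => //.
  by rewrite distrC ltW.
Qed.

(** The hypothesis is the Cauchy condition in the quantitative form that
    the closedness of the range uses. *)
Lemma c0_complete (f : nat -> c0 K) (B : K) :
  (forall k l, `|f k - f l| <= B * (2^-1 ^+ k + 2^-1 ^+ l)) ->
  exists a, forall k, `|f k - a| <= B * 2^-1 ^+ k.
Proof.
move=> f_cauchy.
have half0 k : 0 < 2^-1 ^+ k :> K by rewrite exprn_gt0 // invr_gt0.
have B0 : 0 <= B.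
  have := le_trans (normr_ge0 _) (f_cauchy 0%N 0%N).
  by rewrite pmulr_lge0 // addr_gt0.
have [U [UU U_oo]] := @ultraFilterLemma nat \oo _.
have /choice[a aP] : forall j, exists l, forall e, 0 < e ->
    U [set k | `|f k j - l| <= e].
  move=> j; apply: (ultralimit Kroc UU (B := `|f 0%N| + B * (1 + 1))) => k.
  rewrite -(subrK (f 0%N) (f k)) c0D_coord [leRHS]addrC.
  apply: le_trans (ler_normD _ _) _; apply: lerD; last exact: c0_coord_le.
  apply: le_trans (c0_coord_le _ _) _; apply: le_trans (f_cauchy k 0%N) _.
  have half_le1 n : 2^-1 ^+ n <= 1 :> K.
    by apply: exprn_ile1; rewrite ?invr_ge0 // invf_le1 // ler1n.
  by apply: ler_wpM2l => //; apply: lerD.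
have close k j : `|f k j - a j| <= B * 2^-1 ^+ k.
  apply/ler_addgt0Pr => e e0; have e20 : 0 < e / 2 by rewrite divr_gt0.
  have B1 : 0 < B + 1 by rewrite ltr_wpDl.
  have [N hN] := half_powers_small Kroc (divr_gt0 e20 B1).
  have [l /= [al Nl]] :=
    filter_ex (filterI (aP j _ e20) (U_oo _ (nbhs_infty_ge N))).
  rewrite -(subrKA (f l j)); apply: le_trans (ler_normD _ _) _.
  rewrite [in leRHS](splitr e) addrA; apply: lerD => //.
  apply: le_trans (c0_coord_le (f k - f l) j) _.
  apply: le_trans (f_cauchy k l) _; rewrite mulrDr lerD2l.
  have := ltW (hN l Nl); rewrite ler_pdivlMr // mulrC; apply: le_trans.
  by apply: ler_wpM2r; [exact: ltW|rewrite lerDl].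
have a_null : (a : nat -> K^o) \in @null_sequence K.
  apply/null_sequenceP => e e0; have e20 : 0 < e / 2 by rewrite divr_gt0.
  have B1 : 0 < B + 1 by rewrite ltr_wpDl.
  have [k hk] := half_powers_small Kroc (divr_gt0 e20 B1).
  have [N fN] := c0_tail (f k) e20; exists N => j /fN fj.
  rewrite (_ : a j = f k j - (f k j - a j)); last by ring.
  rewrite (splitr e); apply: le_lt_trans (ler_normB _ _) _; apply: ltr_leD => //.
  apply: le_trans (close k j) _.
  have := ltW (hk k (leqnn k)); rewrite ler_pdivlMr // mulrC; apply: le_trans.
  by apply: ler_wpM2r; [exact: ltW|rewrite lerDl].
exists (C0 a_null) => k; apply: c0_norm_le => j; exact: close.
Qed.

Lemma c0_like_contains_copy : contains_copy_of_c0 E.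
Proof.
have [J JP] := c0_like_embedding.
have J_le a : `|J a| <= b * `|a| by have [] := JP a.
have b20 : 0 < b / 2 by rewrite divr_gt0.
have J_ge a : `|a| <= (b / 2)^-1 * `|J a|.
  by rewrite mulrC ler_pdivlMr // mulrC; have [] := JP a.
have J_inj a c : J a = J c -> a = c.
  move=> Jac; apply/eqP; rewrite -subr_eq0 -normr_le0.
  by apply: le_trans (J_ge _) _; rewrite linearB /= Jac subrr normr0 mulr0.
pose J' y := xget 0 [set a | J a = y].
have J'K : cancel J J'.
  by move=> a; apply: xget_unique => // c /J_inj.
exists (range J); split; last first.
- exists J, J'; split=> //.
  + apply/linear_bounded_continuous/linear_boundedP.
    exists b; split; first exact: gtr0_real.
    move=> r br a; apply: le_trans (J_le a) _.
    by rewrite ler_wpM2r // ltW.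
  + apply/subspace_continuousP => _ [a _ <-]; rewrite /from_subspace J'K.
    apply/cvgrPdist_lt => e e0; rewrite near_withinE.
    have /cvgrPdist_lt/(_ _ (mulr_gt0 b20 e0)) near_Ja : id @ nbhs (J a) --> J a.
      by [].
    near=> y => -[c _ cy]; rewrite -cy J'K; apply: le_lt_trans (J_ge _) _.
    rewrite linearB /= cy mulrC ltr_pdivrMr // mulrC.
    by near: y.
- split; first by apply/mem_set; exists 0 => //; rewrite linear0.
  move=> t _ _ /set_mem[a _ <-] /set_mem[c _ <-]; apply/mem_set.
  by exists (t *: a + c) => //; rewrite linearP.
move=> y y_adh.
have half0 k : 0 < 2^-1 ^+ k :> K by rewrite exprn_gt0 // invr_gt0.
have /choice[f fP] : forall k, exists a, `|y - J a| < 2^-1 ^+ k.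
  move=> k; have [_ [[a _ <-]]] := y_adh _ (nbhsx_ballx y _ (half0 k)).
  by rewrite -ball_normE; exists a.
have [|a aP] := @c0_complete f (b / 2)^-1.
  move=> k l; apply: le_trans (J_ge _) _.
  apply: ler_wpM2l; first by rewrite invr_ge0 ltW.
  rewrite linearB /= -(subrKA y); apply: le_trans (ler_normD _ _) _.
  by rewrite distrC; apply: lerD; exact: ltW.
exists a => //; apply/eqP; rewrite eq_sym -subr_eq0 -normr_le0.
apply/ler_addgt0Pr => e e0; rewrite add0r.
have [k hk] := half_powers_small Kroc (divr_gt0 e0 (ltr0n K 3)).
rewrite -(subrKA (J (f k))) -linearB; apply: le_trans (ler_normD _ _) _.
have -> : e = e / 3 + b * ((b / 2)^-1 * (e / 3)) by field; rewrite gt_eqF.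
have := ltW (hk k (leqnn k)) => hk'.
apply: lerD; first by apply: le_trans hk'; exact: ltW.
apply: le_trans (J_le _) _; apply: ler_wpM2l; first exact: ltW.
by apply: le_trans (aP k) _; rewrite ler_wpM2l // invr_ge0 ltW.
Unshelve. all: by end_near.
Qed.

End CopyOfC0.

(** * Orbits with totally bounded differences *)

Lemma iter_linear (K : numFieldType) (E : lmodType K) (U : {linear E -> E}) n :
  linear (iter n U).
Proof.
by move=> t x y; elim: n => //= n ->; rewrite linearP.
Qed.

Lemma iter_linearB (K : numFieldType) (E : lmodType K) (U : {linear E -> E}) n
    x y : iter n U (x - y) = iter n U x - iter n U y.
Proof. by rewrite -(linear_ofE (iter_linear U n)) linearB. Qed.

Section Kadets.
Variables (K : numFieldType) (E : normedModType K) (U : {linear E -> E}).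
Variables (M : K) (M0 : 0 <= M).
Hypothesis U_le : forall n v, `|iter n U v| <= M * `|v|.
Hypothesis U_ge : forall n v, `|v| <= M * `|iter n U v|.

(** By telescoping: [iter n U v - v] is the sum of the
    [iter j U (U v - v)]. *)
Lemma iter_increment_le v n : `|iter n U v - v| <= n%:R * (M * `|U v - v|).
Proof.
elim: n => [|n IH]; first by rewrite subrr normr0 mul0r.
rewrite iterSr -(subrKA (iter n U v)) -iter_linearB -natr1 mulrDl mul1r addrC.
by apply: le_trans (ler_normD _ _) _; apply: lerD.
Qed.

(** If small displacement of [U x - x] always forced small displacement of [x],
    the finitely many classes that cover the orbit of [U x - x] would cover the
    orbit of [x]. *)
Lemma displaced_almost_period x :
  totally_bounded (range (fun n => iter n U (U x - x))) ->
  ~ totally_bounded (range (fun n => iter n U x)) ->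
  exists2 e, 0 < e & forall de, 0 < de -> exists n,
    `|iter n U (U x - x) - (U x - x)| < de /\ e <= `|iter n U x - x|.
Proof.
set y := U x - x => y_tb x_tb; apply: contrapT => none; apply: x_tb => e e0.
have M1 : 0 < M + 1 by rewrite ltr_wpDl.
have MM1 : M < M + 1 by rewrite ltrDl.
have e'0 := divr_gt0 e0 M1.
have [de de0 de_small] : exists2 de, 0 < de & forall n,
    `|iter n U y - y| < de -> `|iter n U x - x| < e / (M + 1).
  apply: contrapT => no_de; apply: none; exists (e / (M + 1)) => // de de0.
  apply: contrapT => no_n; apply: no_de; exists de => // n yn.
  rewrite real_ltNge ?normr_real // ?gtr0_real //; apply/negP => xn.
  by apply: no_n; exists n.
pose et := de / (M + 1) / 2.
have et0 : 0 < et by rewrite !divr_gt0.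
have [s sP] := y_tb et et0.
(* [first c] is the least time at which the orbit of [y] is near [c]; taking it
   least makes [n - first c] a genuine difference for every later [n]. *)
have /choice[first firstP] : forall c, exists n0, forall n,
    `|iter n U y - c| < et -> (n0 <= n)%N /\ `|iter n0 U y - c| < et.
  move=> c; have [ex|no] := pselect (exists n, `|iter n U y - c| < et).
    have [n0 n0c min] := ex_minnP ex.
    by exists n0 => n /min.
  by exists 0%N => n nc; exfalso; apply: no; exists n.
exists [seq iter (first c) U x | c <- s] => _ [n _ <-].
have [c cs nc] := sP _ (ex_intro2 _ _ n I erefl).
have [n0n n0c] := firstP c n nc; exists (iter (first c) U x).
  by apply/mapP; exists c.
move: n0n n0c; set n0 := first c => n0n n0c.
have shift v : iter n U v - iter n0 U v = iter n0 U (iter (n - n0) U v - v).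
  by rewrite iter_linearB -iterD subnKC.
rewrite shift; apply: le_lt_trans (U_le _ _) _.
have : `|iter (n - n0) U y - y| < de.
  apply: le_lt_trans (U_ge n0 _) _; rewrite -shift.
  have : `|iter n U y - iter n0 U y| < de / (M + 1).
    rewrite -(subrKA c) [ltRHS]splitr; apply: le_lt_trans (ler_normD _ _) _.
    by apply: ltrD => //; rewrite distrC.
  rewrite ltr_pdivlMr // mulrC; apply: le_lt_trans.
  by apply: ler_wpM2r => //; exact: ltW.
move=> /de_small; rewrite ltr_pdivlMr // mulrC; apply: le_lt_trans.
by apply: ler_wpM2r => //; exact: ltW.
Qed.

(** The displacements [z r = iter (n r) U x - x] are chosen one after the other,
    each moved by at most [2^-1 ^+ r] under every power used before. For
    [s] the sum of the [n i] with [A i], the vector [iter s U x - x], which is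
    bounded, then differs from the sum of these [z i] by at most 2. *)
Lemma displacements_subset_sums x e :
  (forall de, 0 < de -> exists n,
    `|iter n U (U x - x) - (U x - x)| < de /\ e <= `|iter n U x - x|) ->
  exists z : nat -> E, (forall i, e <= `|z i|) /\
    bounded_subset_sums z (M * `|x| + `|x| + 2).
Proof.
move=> period; have /choice[g gP] : forall de, exists n, 0 < de ->
    `|iter n U (U x - x) - (U x - x)| < de /\ e <= `|iter n U x - x|.
  move=> de; have [/period[n nP]|Nde] := pselect (0 < de); first by exists n.
  by exists 0%N => /Nde.
pose de r t : K := 2^-1 ^+ r / (t%:R * M + 1).
have den0 t : 0 < t%:R * M + 1 by rewrite ltr_wpDl // mulr_ge0.
have half0 r : 0 < 2^-1 ^+ r :> K by rewrite exprn_gt0 // invr_gt0.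
have de0 r t : 0 < de r t by rewrite divr_gt0.
pose total r := iteri r (fun k t => (t + g (de k t))%N) 0%N.
pose n r := g (de r (total r)).
pose z r := iter (n r) U x - x.
exists z; split=> [r|r A]; first by have [] := gP _ (de0 r (total r)).
have [s [_ close]] : exists s, (s <= total r)%N /\
    `|iter s U x - x - \sum_(i < r | A i) z i| <= 2 - 2 * 2^-1 ^+ r.
  elim: r => [|r [s [s_le close]]].
    by exists 0%N; rewrite big_ord0 /= !subrr normr0 mulr1 subrr.
  have errE : 2 - 2 * 2^-1 ^+ r.+1 = 2 - 2 * 2^-1 ^+ r + 2^-1 ^+ r :> K.
    by rewrite exprS; field.
  rewrite big_mkcond big_ord_recr -big_mkcond /=; case: (A r); last first.
    exists s; rewrite addr0; split; first exact: leq_trans s_le (leq_addr _ _).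
    by apply: le_trans close _; rewrite errE lerDl ltW.
  exists (s + n r)%N; split; first by rewrite leq_add2r.
  have -> : iter (s + n r) U x - x - (\sum_(i < r | A i) z i + z r) =
      (iter s U x - x - \sum_(i < r | A i) z i) + (iter s U (z r) - z r).
    rewrite {2}/z iter_linearB -iterD.
    have -> : iter (s + n r) U x - x =
        (iter s U x - x) + (iter (s + n r) U x - iter s U x).
      by rewrite [RHS]addrC subrKA.
    by rewrite opprD addrACA.
  rewrite errE; apply: le_trans (ler_normD _ _) _; apply: lerD => //.
  apply: le_trans (iter_increment_le _ _) _.
  have -> : U (z r) - z r = iter (n r) U (U x - x) - (U x - x).
    rewrite iter_linearB -iterSr iterS /z linearB /=.
    by rewrite !opprB addrACA [RHS]addrACA; congr (_ + _); rewrite addrC.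
  have [/ltW h _] := gP _ (de0 r (total r)).
  rewrite -/(n r) ler_pdivlMr // in h.
  apply: le_trans h; rewrite mulrA mulrC; apply: ler_wpM2l => //.
  by apply: le_trans (_ : (total r)%:R * M <= _); rewrite ?lerDl // ler_wpM2r // ler_nat.
have -> : \sum_(i < r | A i) z i = (iter s U x - x) -
    (iter s U x - x - \sum_(i < r | A i) z i) by rewrite opprB addrC subrK.
apply: le_trans (ler_normB _ _) _; apply: lerD.
  by apply: le_trans (ler_normB _ _) _; apply: lerD.
by apply: le_trans close _; rewrite gerBl mulr_ge0 // ltW.
Qed.

End Kadets.

(** The discrete form of Kadets's theorem on integrals of almost periodic
    functions: an orbit that is not totally bounded although its differences are
    yields a sequence bounded away from 0 with bounded subset sums. *)
Lemma kadets_differences (K : numFieldType) (Kroc : real_or_complex K)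
    (E : completeNormedModType K) (U : {linear E -> E}) (M : K) (x : E) :
  0 <= M -> (forall n v, `|iter n U v| <= M * `|v|) ->
  (forall n v, `|v| <= M * `|iter n U v|) -> ~ contains_copy_of_c0 E ->
  totally_bounded (range (fun n => iter (n + 1) U x - iter n U x)) ->
  totally_bounded (range (fun n => iter n U x)).
Proof.
move=> M0 U_le U_ge no_c0 diff_tb; apply: contrapT => orbit_tb; apply: no_c0.
have y_tb : totally_bounded (range (fun n => iter n U (U x - x))).
  apply: totally_bounded_sub diff_tb => _ [n _ <-]; exists n => //.
  by rewrite addn1 iter_linearB -iterSr.
have [e e0 period] := displaced_almost_period M0 U_le U_ge y_tb orbit_tb.
have [z [ze z_sums]] := displacements_subset_sums M0 U_le period.
have [u [b [b0 u_c0]]] := james_blocks Kroc e0 ze z_sums.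
exact: (@c0_like_contains_copy K Kroc E u b b0 u_c0).
Qed.

(** * The characterization *)

Section OperatorNorm.
Variables (K : numFieldType) (Kroc : real_or_complex K) (E : normedModType K).

(** Boundedness of [A] is what keeps [opnorm A] from being the default value of
    the supremum. *)
Lemma opnorm_supremum (A : E -> E) (B : K) :
  (forall x, `|A x| <= B * `|x|) -> 0 <= B ->
  supremums [set `|A x| | x in [set x : E | `|x| <= 1]] (opnorm A).
Proof.
move=> AB B0; set D := [set _ | _ in _].
have D0 : D !=set0 by exists `|A 0|, 0 => //=; rewrite normr0.
have [_ [v _ <-]||s sD] := @real_or_complex_sup K D Kroc D0.
- exact: normr_real.
- exists B => _ [v v1 <-]; apply: le_trans (AB v) _.
  by rewrite ler_piMr.
rewrite /opnorm -/D /supremum ifF; last by apply/negbTE/set0P.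
by case: xgetP => [t -> //|/(_ s)].
Qed.

Lemma bounded_operator_bound (T : {linear E -> E}) :
  bounded_operator T -> exists2 r, 0 <= r & forall v, `|T v| <= r * `|v|.
Proof.
by move=> /linear_boundedP/pinfty_ex_gt0[r r0 Tr]; exists r => //; exact: ltW.
Qed.

Lemma bound_bounded_operator (T : {linear E -> E}) (r : K) :
  0 <= r -> (forall v, `|T v| <= r * `|v|) -> bounded_operator T.
Proof.
move=> r0 Tr; apply/linear_boundedP; exists r; split; first exact: ger0_real.
by move=> s rs v; apply: le_trans (Tr v) _; rewrite ler_wpM2r // ltW.
Qed.

Lemma power_bounded_bound (T : {linear E -> E}) :
  bounded_operator T -> power_bounded T ->
  exists2 M, 0 <= M & forall n v, `|iter n T v| <= M * `|v|.
Proof.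
move=> /bounded_operator_bound[r r0 Tr] [M TM].
have Tn n v : `|iter n T v| <= r ^+ n * `|v|.
  elim: n => [|n IH]; first by rewrite mul1r.
  rewrite iterS exprS -mulrA; apply: le_trans (Tr _) _.
  exact: ler_wpM2l.
have sup n := opnorm_supremum (Tn n) (exprn_ge0 n r0).
have unit_le n v : `|v| <= 1 -> `|iter n T v| <= M.
  move=> v1; apply: le_trans (TM _ (ex_intro2 _ _ n I erefl)).
  by apply: (sup n).1; exists v.
have M0 : 0 <= M.
  by apply: le_trans (unit_le 0%N 0 _); rewrite ?normr0.
exists M => // n v; have [->|v0] := eqVneq v 0.
  by rewrite -(linear_ofE (iter_linear T n)) linear0 !normr0 mulr0.
have nv0 : 0 < `|v| by rewrite normr_gt0.
have := unit_le n (`|v|^-1 *: v); rewrite -(linear_ofE (iter_linear T n)).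
rewrite linearZ /= !normrZ normfV normr_id mulVf ?gt_eqF // => /(_ (lexx 1)).
by rewrite mulrC ler_pdivrMr.
Qed.

Lemma bound_power_bounded (T : E -> E) (M : K) : 0 <= M ->
  (forall n v, `|iter n T v| <= M * `|v|) -> power_bounded T.
Proof.
move=> M0 TM; exists M => _ [n _ <-].
apply: (opnorm_supremum (TM n) M0).2 => _ [v /= v1 <-].
by apply: le_trans (TM n v) _; rewrite ler_piMr.
Qed.

Lemma doubly_power_bounded_bounds (T : {linear E -> E}) :
  bounded_operator T -> doubly_power_bounded T ->
  exists M, [/\ 0 <= M, forall n v, `|iter n T v| <= M * `|v| &
    forall n v, `|v| <= M * `|iter n T v|].
Proof.
move=> T_bd [T_pb [S [S_bd TS _ S_pb]]].
have [M M0 TM] := power_bounded_bound T_bd T_pb.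
have [N N0 SN] := power_bounded_bound S_bd S_pb.
exists (M + N); split=> [|n v|n v]; first exact: addr_ge0.
  by apply: le_trans (TM n v) _; rewrite ler_wpM2r // lerDl.
have -> : `|v| = `|iter n S (iter n T v)|.
  by elim: n v => // n IH v; rewrite [iter n.+1 S _]iterSr iterS TS.
by apply: le_trans (SN _ _) _; rewrite ler_wpM2r // lerDr.
Qed.

End OperatorNorm.

Section Necessity.
Variables (K : numFieldType) (Kroc : real_or_complex K).
Variable E : completeNormedModType K.

(** Applied to [iter m T], Kadets's theorem covers the times divisible by [m];
    the orbit is the union of the images of that part under the first [m]
    powers. *)
Lemma totally_bounded_orbit (T : {linear E -> E}) (M : K) x m :
  0 <= M -> (forall n v, `|iter n T v| <= M * `|v|) ->
  (forall n v, `|v| <= M * `|iter n T v|) -> ~ contains_copy_of_c0 E ->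
  (0 < m)%N ->
  totally_bounded (range (fun n => iter (n + m) T x - iter n T x)) ->
  totally_bounded (range (fun n => iter n T x)).
Proof.
move=> M0 TM TM' no_c0 m0 diff_tb.
pose V := linear_of (iter_linear T m).
have VE n v : iter n V v = iter (n * m) T v.
  by elim: n => //= n ->; rewrite mulSn iterD.
have V_tb : totally_bounded (range (fun n => iter n V x)).
  apply: (kadets_differences Kroc M0) no_c0 _ => [n v|n v|]; rewrite ?VE //.
  apply: totally_bounded_sub diff_tb => _ [n _ <-]; exists (n * m)%N => //.
  by rewrite !VE addn1 mulSn addnC.
pose R r := iter r T @` range (fun n => iter n V x).
have R_tb : totally_bounded (\bigcup_(r in [set r | (r < m)%N]) R r).
  apply: totally_bounded_bigcup => r _.
  apply: (totally_bounded_lipschitz M0) V_tb => v w.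
  by rewrite -iter_linearB.
apply: totally_bounded_sub R_tb => _ [n _ <-]; exists (n %% m)%N.
  by rewrite /= ltn_mod.
exists (iter (n %/ m) V x); first by exists (n %/ m)%N.
by rewrite VE -iterD addnC -divn_eq.
Qed.

Lemma totally_bounded_differences (T : {linear E -> E}) (M : K) x m :
  0 <= M -> (forall n v, `|iter n T v| <= M * `|v|) ->
  totally_bounded (range (fun n => iter n T x)) ->
  totally_bounded (range (fun n => iter (n + m) T x - iter n T x)).
Proof.
move=> M0 TM orbit_tb.
have -> : range (fun n => iter (n + m) T x - iter n T x) =
    (fun v => iter m T v - v) @` range (fun n => iter n T x).
  apply/seteqP; split=> [_ [n _ <-]|_ [_ [n _ <-] <-]].
    by exists (iter n T x); [exists n|rewrite -iterD addnC].
  by exists n => //; rewrite -iterD addnC.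
apply: (@totally_bounded_lipschitz _ _ _ _ (M + 1)) orbit_tb => [|v w].
  by rewrite addr_ge0.
have -> : iter m T v - v - (iter m T w - w) = iter m T (v - w) - (v - w).
  by rewrite iter_linearB !opprB addrACA [RHS]addrACA [- v + _]addrC.
by rewrite mulrDl mul1r; apply: le_trans (ler_normB _ _) _; apply: lerD.
Qed.

End Necessity.

Section Sufficiency.
Variables (K : numFieldType) (Kroc : real_or_complex K).
Variable E : normedModType K.

(** Boundedness below is continuity of the inverse at 0, tested on multiples of
    [a] whose image has norm [de / 2]. *)
Lemma copy_of_c0_embedding : contains_copy_of_c0 E ->
  exists (J : {linear c0 K -> E}) (b C : K),
    [/\ 0 <= b, 0 <= C, forall a, `|J a| <= b * `|a| &
      forall a, `|a| <= C * `|J a|].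
Proof.
move=> [F [_ _ [J [J' [JF JK J_cont J'_cont]]]]].
have /linear_bounded_continuous/linear_boundedP/pinfty_ex_gt0[b b0 Jb] := J_cont.
have J'0 : J' 0 = 0 by rewrite -(linear0 J) JK.
have F0 : F 0 by rewrite -JF; exists 0 => //; rewrite linear0.
have /subspace_continuousP/(_ 0 F0)/cvgrPdist_lt/(_ 1 ltr01) := J'_cont.
rewrite near_withinE /from_subspace J'0 => /nbhs_norm0P[de /= de0 small].
exists J, b, (2 / de); split; rewrite ?divr_ge0 ?ltW // => a.
have [->|a0] := eqVneq a 0; first by rewrite linear0 !normr0 mulr0.
have Ja0 : 0 < `|J a|.
  rewrite normr_gt0; apply/eqP => Ja; case/eqP: a0.
  by rewrite -(JK a) Ja.
pose t := de / 2 / `|J a|; have t0 : 0 < t by rewrite !divr_gt0.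
have := small (J (t *: a)); rewrite /= linearZ /= normrZ (gtr0_norm t0).
rewrite divfK ?gt_eqF // -linearZ JK sub0r normrN normrZ (gtr0_norm t0).
move=> ta; have {}ta : t * `|a| < 1.
  apply: ta; last by rewrite -JF; exists (t *: a).
  by rewrite gtr_pMr // invf_lt1 ?ltr1n.
have -> : 2 / de * `|J a| = t^-1 by rewrite /t; field; rewrite !gt_eqF.
by rewrite -[leRHS]mulr1 ler_pdivlMl // ltW.
Qed.

(** [transport T y] applies [T] to the [c0]-component of [y] and fixes the
    complementary one. *)
Definition transport (J : c0 K -> E) (Q : E -> c0 K) (T : c0 K -> c0 K)
    (y : E) : E := y + J (T (Q y) - Q y).

Section Transport.
Variables (J : {linear c0 K -> E}) (Q : {linear E -> c0 K}).
Hypothesis QJ : forall a, Q (J a) = a.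

Lemma transport_linear (T : {linear c0 K -> c0 K}) : linear (transport J Q T).
Proof.
move=> t x y; rewrite /transport !linearP /= addrACA -scalerDr linearP.
by rewrite [in RHS]scalerDr addrACA.
Qed.

Lemma Q_transport T y : Q (transport J Q T y) = T (Q y).
Proof. by rewrite /transport linearD /= QJ addrC subrK. Qed.

Lemma transport_comp T S y :
  transport J Q S (transport J Q T y) = transport J Q (S \o T) y.
Proof.
rewrite {1}/transport Q_transport /transport /= -addrA -linearD.
by rewrite [_ + (S _ - _)]addrC subrKA.
Qed.

Lemma iter_transport T n y :
  iter n (transport J Q T) y = transport J Q (iter n T) y.
Proof.
elim: n => [|n IH]; first by rewrite /transport subrr linear0 addr0.
by rewrite iterS IH transport_comp.
Qed.

Lemma transportK (T S : c0 K -> c0 K) : cancel T S ->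
  cancel (transport J Q T) (transport J Q S).
Proof.
by move=> TS y; rewrite transport_comp /transport /= TS subrr linear0 addr0.
Qed.

Lemma transport_bound (T : c0 K -> c0 K) (b C : K) :
  0 <= b -> 0 <= C -> (forall a, `|J a| <= b * `|a|) ->
  (forall y, `|Q y| <= C * `|y|) -> (forall n a, `|iter n T a| <= 3 * `|a|) ->
  forall n y, `|iter n (transport J Q T) y| <= (1 + b * (4 * C)) * `|y|.
Proof.
move=> b0 C0 Jb QC T3 n y; rewrite iter_transport mulrDl mul1r.
apply: le_trans (ler_normD _ _) _; apply: lerD => //.
apply: le_trans (Jb _) _; rewrite -mulrA; apply: ler_wpM2l => //.
apply: le_trans (ler_normB _ _) _.
have -> : 4 * C * `|y| = 3 * (C * `|y|) + C * `|y| by ring.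
apply: lerD => //; apply: le_trans (T3 _ _) _; exact: ler_wpM2l.
Qed.

End Transport.

(** The projection [J \o Q] lets the operator of [c0_counterexample] act on the
    copy of [c0] and the identity on the kernel of [Q]. *)
Lemma copy_of_c0_operator : separable E -> contains_copy_of_c0 E ->
  exists T : {linear E -> E}, [/\ bounded_operator T, doubly_power_bounded T &
    exists x, totally_bounded (range (fun n => iter (n + 1) T x - iter n T x)) /\
      ~ totally_bounded (range (fun n => iter n T x))].
Proof.
move=> /separable_dense_sequence[d d_dense].
move=> /copy_of_c0_embedding[J [b [C [b0 C_ge0 Jb JC]]]].
have [Q [D [D0 QD QJ]]] := sobczyk Kroc d_dense C_ge0 JC.
have [T [S [x [[TS ST] T3 S3 diff_tb wander]]]] := c0_counterexample Kroc.
pose T' := linear_of (transport_linear J Q T).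
pose S' := linear_of (transport_linear J Q S).
have B0 : 0 <= 1 + b * (4 * D) by rewrite addr_ge0 // !mulr_ge0.
have T'B := transport_bound QJ b0 D0 Jb QD T3.
have S'B := transport_bound QJ b0 D0 Jb QD S3.
exists T'; split.
- by apply: (bound_bounded_operator (T := T') B0) => v; exact: (T'B 1%N v).
- split; first exact: (bound_power_bounded Kroc B0 T'B).
  exists S'; split.
  + by apply: (bound_bounded_operator (T := S') B0) => v; exact: (S'B 1%N v).
  + by move=> y; exact: (transportK QJ TS y).
  + by move=> y; exact: (transportK QJ ST y).
  + exact: (bound_power_bounded Kroc B0 S'B).
have T'E n : iter n T' (J x) = J (iter n T x).
  by rewrite iter_transport // /transport QJ linearB addrC subrK.
exists (J x); split.
  apply: (@totally_bounded_sub _ _ _ (J @` range (fun n =>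
    iter (n + 1) T x - iter n T x))).
    move=> _ [n _ <-]; exists (iter (n + 1) T x - iter n T x); first by exists n.
    by rewrite linearB !T'E.
  by apply: (totally_bounded_lipschitz b0) diff_tb => v w; rewrite -linearB.
move=> orbit_tb.
have : totally_bounded (Q @` range (fun n => iter n T' (J x))).
  by apply: (totally_bounded_lipschitz D0) orbit_tb => v w; rewrite -linearB.
have half : 0 < 2^-1 :> K by rewrite invr_gt0.
move=> /(_ _ half)[s sP].
have [N sN] : exists N, forall c, c \in s -> forall i, (N <= i)%N -> `|c i| < 2^-1.
  elim: s {sP} => [|c s [N sN]]; first by exists 0%N.
  have [N' cN'] := c0_tail c half; exists (maxn N N') => c' c's i.
  rewrite geq_max => /andP[Ni N'i]; move: c's; rewrite inE => /predU1P[->|c's].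
    exact: cN'.
  exact: sN.
have [n [i [Ni Txi]]] := wander N.
have [|c cs close] := sP (iter n T x).
  by exists (iter n T' (J x)); [exists n|rewrite T'E QJ].
have : `|iter n T x i| < 1.
  have -> : iter n T x i = (iter n T x - c) i + c i.
    by rewrite c0D_coord c0N_coord subrK.
  rewrite [1]splitr mul1r; apply: le_lt_trans (ler_normD _ _) _; apply: ltrD.
    by apply: le_lt_trans close; exact: c0_coord_le.
  exact: sN.
by rewrite Txi ltxx.
Qed.

End Sufficiency.

Unset Implicit Arguments.

Theorem mainTheorem1 (K : numFieldType) (K_real_or_complex : real_or_complex K)
    (E : completeNormedModType K) (E_separable : separable E) :
  ~ contains_copy_of_c0 E <->
  forall T : {linear E -> E},
    bounded_operator T -> doubly_power_bounded T ->
    forall x : E,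
      let a := exists2 m, (1 <= m)%N &
        precompact (range (fun n => iter (n + m) T x - iter n T x)) in
      let b := forall m, (1 <= m)%N ->
        precompact (range (fun n => iter (n + m) T x - iter n T x)) in
      let c := precompact (range (fun n => iter n T x)) in
      (a <-> b) /\ (b <-> c).
Proof.
split=> [no_c0 T T_bd T_dpb x a b c|equiv has_c0].
  have [M [M0 TM TM']] := doubly_power_bounded_bounds K_real_or_complex T_bd T_dpb.
  have ac : a -> c.
    move=> [m m1 /precompact_totally_bounded diff_tb].
    apply: totally_bounded_precompact.
    exact: (@totally_bounded_orbit _ K_real_or_complex E T M x m).
  have cb : c -> b.
    move=> /precompact_totally_bounded orbit_tb m _.
    apply: totally_bounded_precompact.
    exact: (@totally_bounded_differences _ E T M x m).
  have ba : b -> a by move=> bP; exists 1%N => //; exact: bP.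
  by split; split=> // h; [exact/cb/ac|exact/ac/ba].
have [T [T_bd T_dpb [x [diff_tb orbit_tb]]]] :=
  copy_of_c0_operator K_real_or_complex E_separable has_c0.
have [ab bc] := equiv T T_bd T_dpb x; apply: orbit_tb.
apply: precompact_totally_bounded; apply/bc/ab; exists 1%N => //.
exact: totally_bounded_precompact.
Qed.
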